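(* Let $p$ be an odd prime and let $0\le d\le e$ be integers. Let $\nu(d,e)$ denote the number of isomorphism classes of reciprocal pairs of regular dessins whose underlying graph is the complete bipartite graph $K_{p^d,p^e}$. Then (i) if $d=0$ then $\nu(d,e)=1$; (ii) if $0<d=e$ then $\nu(d,e)=\frac{1}{2}p^{e-1}(1+p^{e-1})$; (iii) if $0<d<e$ then $\nu(d,e)=p^{2d-1}$. Moreover, in each case every such dessin, coloured so that its black vertices have valency $p^d$, has type $(p^d,p^e,p^e)$ (black vertices of valency $p^d$, white vertices of valency $p^e$, every face of length $2p^e$), and its supporting surface has genus $\frac{1}{2}(p^d-1)(p^e-2)$.
   Context: A dessin is a $2$-cell embedding of a connected bipartite graph, whose vertices are properly $2$-coloured black and white, into an orientable closed surface. An automorphism of a dessin is a permutation of the edges preserving the graph structure and the vertex colours and extending to an orientation-preserving self-homeomorphism of the surface; the automorphisms form a group acting semiregularly on the edges, and the dessin is regular if this action is transitive. Two dessins are isomorphic if there is a bijection of edges induced by a colour-preserving, orientation-preserving homeomorphism of the surfaces mapping one embedded graph onto the other. The reciprocal dessin $\mathcal D^*$ of $\mathcal D$ is obtained by interchanging the two vertex colours; dessins thus occur in reciprocal pairs $\{\mathcal D,\mathcal D^*\}$ (which consist of a single dessin when $\mathcal D\cong\mathcal D^*$). The type of a regular dessin is $(l,m,n)$ where $l$, $m$ are the valencies of the black and white vertices and every face has length $2n$. *)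

(* Defs.v *)
From HB Require Import structures.
From mathcomp Require Import all_boot all_order all_algebra all_fingroup.

Set Implicit Arguments.
Unset Strict Implicit.
Unset Printing Implicit Defensive.

Import GroupScope.

(* A 2-cell embedding of a connected bipartite graph in an oriented closed     *)
(* surface is encoded by its rotation system: rotb (resp. rotw) sends an edge  *)
(* to the next one, in the positive direction, around its black (resp. white)  *)
(* end. The embedded graph is connected iff these two permutations generate    *)
(* a transitive group ([transitive _, on _ | _] also forces edge to be         *)
(* inhabited).                                                                 *)
Record dessin := Dessin {
  edge : finType;
  rotb : {perm edge};
  rotw : {perm edge};
  dessin_connected :
    [transitive <<[set rotb; rotw]>>, on [set: edge] | 'P] }.

(* A vertex is identified with the set of the edges incident with it. *)
Definition black (D : dessin) : {set {set edge D}} := porbits (rotb D).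
Definition white (D : dessin) : {set {set edge D}} := porbits (rotw D).

(* (rotb * rotw) e is rotw (rotb e): going once along the boundary of a face   *)
(* passes alternately through its black and white corners, so a cycle of       *)
(* rotb * rotw of length n is a face whose boundary walk has length 2n.        *)
Definition faces (D : dessin) : {set {set edge D}} :=
  porbits (rotb D * rotw D).
Definition face_length (D : dessin) (F : {set edge D}) : nat := (2 * #|F|)%N.

Definition dessin_isom (D D' : dessin) (f : edge D -> edge D') : Prop :=
  [/\ bijective f,
      forall a, f (rotb D a) = rotb D' (f a) &
      forall a, f (rotw D a) = rotw D' (f a)].

Definition isomorphic (D D' : dessin) : Prop :=
  exists f : edge D -> edge D', dessin_isom f.

Definition automorphism (D : dessin) (f : {perm edge D}) : Prop :=
  dessin_isom f.

Definition regular (D : dessin) : Prop :=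
  forall a b : edge D, exists2 f : {perm edge D}, automorphism f & f a = b.

Lemma reciprocal_connected (D : dessin) :
  [transitive <<[set rotw D; rotb D]>>, on [set: edge D] | 'P].
Proof. by rewrite setUC dessin_connected. Qed.

Definition reciprocal (D : dessin) : dessin :=
  Dessin (reciprocal_connected D).

(* Isomorphism of the reciprocal pairs {D, D^*} and {D', D'^*}. *)
Definition pair_isomorphic (D D' : dessin) : Prop :=
  isomorphic D D' \/ isomorphic D (reciprocal D').

(* As K_{m,n} carries no colouring, either colour class may be the one with m  *)
(* vertices.                                                                   *)
Definition underlying_graph_K (m n : nat) (D : dessin) : Prop :=
  [/\ (#|black D| = m /\ #|white D| = n) \/ (#|black D| = n /\ #|white D| = m) &
      forall B W, B \in black D -> W \in white D -> #|B :&: W| = 1%N].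

Definition has_type (D : dessin) (l m n : nat) : Prop :=
  [/\ forall B, B \in black D -> #|B| = l,
      forall W, W \in white D -> #|W| = m &
      forall F, F \in faces D -> face_length F = (2 * n)%N].

Definition euler_char (D : dessin) : int :=
  ((#|black D| + #|white D|)%:Z - #|edge D|%:Z + #|faces D|%:Z)%R.

Definition genus (D : dessin) : rat := (1 - (euler_char D)%:~R / 2)%R.

(* The objects satisfying P fall into exactly N classes for R. *)
Definition number_of_classes (T : Type) (P : T -> Prop) (R : T -> T -> Prop)
    (N : nat) : Prop :=
  exists s : 'I_N -> T,
    [/\ forall i, P (s i),
        forall i j, R (s i) (s j) -> i = j &
        forall x, P x -> exists i, R x (s i)].

Definition number_of_reciprocal_pairs (m n N : nat) : Prop :=
  number_of_classes (fun D => regular D /\ underlying_graph_K m n D)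
    pair_isomorphic N.

(* Main.v *)
(* The monodromy group of a regular embedding of K_(p^d, p^e) is a p-group     *)
(* G = <a><b> with a, b of orders p^d, p^e, where a and b are the rotations    *)
(* about the black and the white vertices. Then c = [a, b] = a^i b^j with p    *)
(* dividing i and j, since c lies in the Frattini subgroup. As p is odd, this  *)
(* forces G' = <c>, so commutators and p-power maps in G can be controlled by  *)
(* the cyclic group <c>: for instance <[a^(p^k), b]> = <c^(p^k)>. Taking k = d *)
(* gives p^(e-d) | j, and ab has order p^e, whence the type and the genus.     *)
(* Conversely any finite p-group generated by a, b with such a relation is     *)
(* <a><b>; applied to a subgroup of a product of two monodromy groups, this    *)
(* shows that (i, j) determines the dessin. All the pairs allowed by the       *)
(* divisibility conditions occur: for d = e take a = h b^B in a split          *)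
(* metacyclic group <h><b> with h^b = h^L, where the relation becomes a        *)
(* fixed-point equation for L which is solved p-adically; for d < e take the   *)
(* quotient by the normal subgroup <a^(p^d)> of the group for (e, e). For      *)
(* d = e, reciprocity acts on the pairs (i, j) as (i, j) |-> (-j, -i).         *)

Require Import Defs.
From HB Require Import structures.
From mathcomp Require Import all_boot all_order all_algebra all_fingroup.
From mathcomp Require Import all_solvable ring zify.

Set Implicit Arguments.
Unset Strict Implicit.
Unset Printing Implicit Defensive.

(** * Two-generator p-groups *)

(** The monodromy group G of a regular dessin acts regularly on the edges, so dessins are classified
    by groups with a generating pair (a, b). The graph is K_(p^d, p^e) exactly when G = [<a><b>]
    with trivial intersection ([bicyclic_monodromy], [regular_K_of_bicyclic]). Then [a, b] = a^i b^j
    with i, j unique modulo p^d, p^e. The constraints are p | i, p | j and p^(e-d) | j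
    ([bicyclic_commg_code], [bicyclic_code_dvdn]). Codes obeying them all occur ([bicyclic_exists]),
    and the code determines the dessin ([isomorphic_of_commg]). Behind this stand two facts on
    p-groups with such a relation: [a, b] generates a normal cyclic subgroup ([commg_cycle_normal]),
    and G = [<a><b>] ([powerful_mulG]).

    Write i = px and j = -p^k y with k = max(1, e-d). If d = 0, only x = y = 0 remains. If 0 < d < e
    there are p^(d-1) p^d codes, and reciprocity identifies none of them because the colour classes
    differ in size. If 0 < d = e there are p^(e-1) values for each of x and y, and reciprocity swaps
    x with y, so unordered pairs are counted. *)

Section PGroups.
Import GroupScope.
Implicit Types (p : nat) (gT : finGroupType).

(** By nilpotence [[<w>, <g>]] is a proper subgroup of the cyclic p-group [<w>], hence lies in its
    maximal subgroup [<w^p>]. *)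
Lemma pgroup_commg_cycle p gT (G : {group gT}) (w g : gT) :
  prime p -> p.-group G -> <[w]> <| G -> g \in G -> [~ w, g] \in <[w ^+ p]>.
Proof.
move=> p_pr pG nwG gG; have [sWG nWG] := andP nwG.
have [->|ntw] := eqVneq w 1; first by rewrite comm1g group1.
have wG : w \in G by rewrite -cycle_subG.
have [k cE] : exists k, [~ w, g] = w ^+ k.
  apply/cycleP; rewrite commgEl groupM ?groupV ?cycle_id //.
  by rewrite memJ_norm ?cycle_id // (subsetP nWG).
have prp : [~: <[w]>, <[g]>] \proper <[w]>.
  apply: (nil_comm_properl (pgroup_nil pG)) => //; first by rewrite cycle_eq1.
  by rewrite cycle_subG inE gG (subsetP nWG).
have ordw : p.-nat #[w] by apply: mem_p_elt pG _.
rewrite cE; have [/dvdnP[m ->]|ndv] := boolP (p %| k).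
  by rewrite mulnC expgM mem_cycle.
case/negP: (proper_subn prp); rewrite cycle_subG.
have : generator <[w]> (w ^+ k).
  rewrite generator_coprime.
  by have [n ->] := p_natP ordw; rewrite coprimeXl // prime_coprime.
move/eqP=> gen; have: w \in <[w ^+ k]> by rewrite -gen cycle_id.
by apply/subsetP; rewrite cycle_subG -cE mem_commg ?cycle_id.
Qed.

(** Modulo [<w^p>] the commutator is central by [pgroup_commg_cycle], so the class-2 power formula
    applies. Its correction has exponent p(p-1)/2, a multiple of the odd prime p. *)
Lemma expMg_prime_cycle p gT (G : {group gT}) (w x y : gT) :
    prime p -> odd p -> p.-group G -> <[w]> <| G -> x \in G -> y \in G ->
    [~ x, y] \in <[w]> ->
  exists2 z, z \in <[w ^+ p]> & (x * y) ^+ p = x ^+ p * y ^+ p * z.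
Proof.
move=> p_pr p_odd pG nwG xG yG cw.
have nwpG : <[w ^+ p]> <| G.
  by apply: char_normal_trans nwG; rewrite cycle_subgroup_char // cycleX.
have NG g : g \in G -> g \in 'N(<[w ^+ p]>) by apply/subsetP/normal_norm.
have wG : w \in G by rewrite -cycle_subG normal_sub.
have inv : [~ y, x] \in <[w]> by rewrite -invg_comm groupV.
have zG : [~ y, x] \in G by apply: groupR.
have com g : g \in G -> commute (coset <[w ^+ p]> g) (coset <[w ^+ p]> [~ y, x]).
  move=> gG; have rG : [~ [~ y, x], g] \in G by apply: groupR.
  have gzG : g * [~ y, x] \in G by apply: groupM.
  have rw : [~ [~ y, x], g] \in <[w ^+ p]>.
    have /subsetP-> // : <[[~ y, x] ^+ p]> \subset <[w ^+ p]>.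
      by case/cycleP: inv => k ->; rewrite cycle_subG -expgM mulnC expgM mem_cycle.
    apply: pgroup_commg_cycle p_pr pG _ gG.
    by apply: char_normal_trans nwG; rewrite cycle_subgroup_char // cycle_subG.
  rewrite /commute -!morphM ?NG // (commgC [~ y, x]) [RHS]morphM ?NG //.
  by rewrite [X in _ = _ * X]coset_id ?mulg1.
have xyG : x ^+ p * y ^+ p \in G by rewrite groupM ?groupX.
have E : coset <[w ^+ p]> ((x * y) ^+ p) = coset <[w ^+ p]> (x ^+ p * y ^+ p).
  rewrite [LHS]morphX ?NG ?groupM // morphM ?NG //.
  rewrite expMg_Rmul -?morphR ?NG //.
  - rewrite [RHS]morphM ?NG ?groupX // !(morphX _ p) ?NG //.
    rewrite -[X in _ * X = _]morphX ?NG // [X in _ * X = _]coset_id ?mulg1 //.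
    have /dvdnP[k ->] : p %| 'C(p, 2).
      by apply: prime_dvd_bin => //; rewrite odd_prime_gt2.
    by case/cycleP: inv => t ->; rewrite -expgM mulnA mulnC expgM mem_cycle.
  - exact: com.
  - exact: com.
have [z zW eq] := kercoset_rcoset (NG _ (groupX p (groupM xG yG))) (NG _ xyG) E.
exists (z ^ (x ^+ p * y ^+ p)); last by rewrite eq -conjgC.
by rewrite memJ_norm // NG.
Qed.

Lemma mem_cycleX gT (w z : gT) n : z \in <[w]> -> z ^+ n \in <[w ^+ n]>.
Proof. by case/cycleP=> i ->; rewrite -expgM mulnC expgM mem_cycle. Qed.

Lemma cycleX_normal gT (G : {group gT}) (w : gT) n :
  <[w]> <| G -> <[w ^+ n]> <| G.
Proof. by apply: char_normal_trans; rewrite cycle_subgroup_char // cycleX. Qed.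

Lemma mem_commg_cycle gT (G : {group gT}) (w x y : gT) :
  <[w]> <| G -> x \in <[w]> -> y \in G -> [~ x, y] \in <[w]>.
Proof.
move=> /normal_norm/subsetP nwG wx yG.
by rewrite commgEl groupM ?groupV // memJ_norm // nwG.
Qed.

Lemma commXg_prime_cycle p gT (G : {group gT}) (w x y : gT) :
    prime p -> odd p -> p.-group G -> <[w]> <| G -> x \in G -> y \in G ->
    [~ x, y] \in <[w]> ->
  [~ x ^+ p, y] \in <[w ^+ p]>.
Proof.
move=> p_pr p_odd pG nwG xG yG cw.
have cG : [~ x, y] \in G by apply: groupR.
have [|z zw e] := @expMg_prime_cycle p _ G w x [~ x, y] p_pr p_odd pG nwG xG cG.
  by rewrite -invg_comm groupV (mem_commg_cycle nwG).
have xyE : x ^ y = x * [~ x, y] by rewrite commgEl mulKVg.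
rewrite commgEl conjXg xyE e -mulgA mulKg groupM //.
exact: mem_cycleX.
Qed.

Lemma commXg_pexp_cycle p gT (G : {group gT}) (w x y : gT) k :
    prime p -> odd p -> p.-group G -> <[w]> <| G -> x \in G -> y \in G ->
    [~ x, y] \in <[w]> ->
  [~ x ^+ (p ^ k), y] \in <[w ^+ (p ^ k)]>.
Proof.
move=> p_pr p_odd pG nwG xG yG cw; elim: k => [|k IH]; first by rewrite !expg1.
rewrite expnSr !expgM; apply: (@commXg_prime_cycle p _ G) => //.
  exact: cycleX_normal.
exact: groupX.
Qed.

Lemma expMg_pexp_cycle p gT (G : {group gT}) (w x y : gT) k :
    prime p -> odd p -> p.-group G -> <[w]> <| G -> x \in G -> y \in G ->
    [~ x, y] \in <[w]> ->
  exists2 z, z \in <[w ^+ (p ^ k)]> &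
    (x * y) ^+ (p ^ k) = x ^+ (p ^ k) * y ^+ (p ^ k) * z.
Proof.
move=> p_pr p_odd pG nwG xG yG cw; elim: k => [|k [z zw e]].
  by exists 1; rewrite ?group1 ?mulg1.
have nwkG := cycleX_normal (p ^ k) nwG.
have [XG YG] : x ^+ (p ^ k) \in G /\ y ^+ (p ^ k) \in G by rewrite !groupX.
have zG : z \in G by apply: subsetP (normal_sub nwkG) _ zw.
have XYG := groupM XG YG.
rewrite expnSr !(expgM _ (p ^ k) p) e.
have [|z1 z1w ->] := expMg_prime_cycle p_pr p_odd pG nwkG XYG zG.
  by rewrite -invg_comm groupV (mem_commg_cycle nwkG).
have [|z2 z2w ->] := expMg_prime_cycle p_pr p_odd pG nwkG XG YG.
  have := @commXg_pexp_cycle p _ G w x (y ^+ (p ^ k)) k p_pr p_odd pG nwG xG YG.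
  apply; elim: (p ^ k)%N => [|n IH]; first by rewrite commg1 group1.
  rewrite expgS commgMJ groupM // memJ_norm //.
  by apply: subsetP (normal_norm nwG) _ _; apply: groupX.
exists (z2 * (z ^+ p * z1)); last by rewrite !mulgA.
rewrite groupM // groupM //.
exact: mem_cycleX.
Qed.

Lemma cycle_expg_1mod p gT (v : gT) k :
  prime p -> p.-elt v -> <[v ^+ (1 + p * k)]> = <[v]>.
Proof.
move=> p_pr pv; apply/eqP; rewrite eq_sym; have := generator_coprime v (1 + p * k).
rewrite /generator => ->; have [n ->] := p_natP pv.
by rewrite coprimeXl // prime_coprime // dvdn_addl ?dvdn_mulr // Euclid_dvd1.
Qed.

Lemma cycle_commXg_prime p gT (G : {group gT}) (x y : gT) :
    prime p -> odd p -> p.-group G -> x \in G -> y \in G -> <[[~ x, y]]> <| G ->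
  <[[~ x ^+ p, y]]> = <[[~ x, y] ^+ p]>.
Proof.
move=> p_pr p_odd pG xG yG; set c := [~ x, y] => ncG.
have cG : c \in G by apply: groupR.
(* Taking w = c^p puts the error in [<c^(p^2)>], so [x^p, y] is c^p raised to some 1 + pk, a unit
   modulo the order. *)
have [|z zw e] :=
  @expMg_prime_cycle p _ G (c ^+ p) x c p_pr p_odd pG (cycleX_normal p ncG) xG cG.
  by rewrite -invg_comm groupV (pgroup_commg_cycle p_pr pG ncG).
have xyE : x ^ y = x * c by rewrite /c commgEl mulKVg.
rewrite commgEl conjXg xyE e -mulgA mulKg.
case/cycleP: zw => k ->.
have -> : c ^+ p * c ^+ p ^+ p ^+ k = c ^+ p ^+ (1 + p * k).
  by rewrite expgD expg1 expgM.
by apply: cycle_expg_1mod => //; apply: mem_p_elt pG _; apply: groupX.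
Qed.

Lemma cycle_commXg_pexp p gT (G : {group gT}) (x y : gT) k :
    prime p -> odd p -> p.-group G -> x \in G -> y \in G -> <[[~ x, y]]> <| G ->
  <[[~ x ^+ (p ^ k), y]]> = <[[~ x, y] ^+ (p ^ k)]>.
Proof.
move=> p_pr p_odd pG xG yG ncG; elim: k => [|k IH]; first by rewrite !expg1.
rewrite expnSr !(expgM _ (p ^ k) p).
have nG : <[[~ x ^+ (p ^ k), y]]> <| G by rewrite IH cycleX_normal.
rewrite (cycle_commXg_prime p_pr p_odd pG _ yG nG) ?groupX //.
apply/eqP; rewrite eqEsubset !cycle_subG; apply/andP; split.
  by apply: mem_cycleX; rewrite -IH cycle_id.
by apply: mem_cycleX; rewrite IH cycle_id.
Qed.

(** Conjugating a^p by b gives (ac)^p. The corrections c^p and [c, a]^(p(p-1)/2) both vanish, since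
    [c, a]^p = [c^p, a] = 1. *)
Lemma commute_expg_prime gT p (a b : gT) :
    prime p -> odd p -> [~ a, b] ^+ p = 1 ->
    commute a [~ [~ a, b], a] -> commute [~ a, b] [~ [~ a, b], a] ->
  commute (a ^+ p) b.
Proof.
move=> p_pr p_odd; set c := [~ a, b] => cp1 ca cc.
have abE : a ^ b = a * c by rewrite /c commgEl mulKVg.
apply/commgP/conjg_fixP; rewrite conjXg abE.
rewrite expMg_Rmul // cp1 mulg1.
have /dvdnP[k ->] : p %| 'C(p, 2).
  by apply: prime_dvd_bin => //; rewrite odd_prime_gt2.
by rewrite mulnC expgM -commXg // cp1 comm1g expg1n mulg1.
Qed.

Lemma der1_gen2 gT (G : {group gT}) (a b : gT) :
  G :=: <<[set a; b]>> -> <[[~ a, b]]> <| G -> G^`(1) = <[[~ a, b]]>.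
Proof.
move=> defG ncG.
have [aG bG] : a \in G /\ b \in G by rewrite defG !mem_gen ?set21 ?set22.
apply/eqP; rewrite eqEsubset cycle_subG mem_commg // andbT.
have nG := subsetP (normal_norm ncG).
apply: der1_min; first exact: normal_norm.
rewrite {1}defG quotient_gen; last by rewrite subUset !sub1set !nG.
have com : commute (coset <[[~ a, b]]> a) (coset <[[~ a, b]]> b).
  apply/commgP; rewrite -morphR ?nG //; apply/eqP/coset_id/cycle_id.
rewrite /quotient morphimU !morphim_set1 ?nG // abelian_gen.
by apply/centsP=> x /set2P[] -> y /set2P[] ->.
Qed.

(* Here a^p commutes with b and b^p with a, while [a, b] is a product of       *)
(* powers of a^p and b^p.                                                      *)
Lemma der1_central_of_class3 gT p (G : {group gT}) (a b : gT) i j :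
    prime p -> odd p -> G :=: <<[set a; b]>> ->
    p %| i -> p %| j -> [~ a, b] = a ^+ i * b ^+ j -> [~ a, b] ^+ p = 1 ->
    [~: [~: G^`(1), G], G] = 1 ->
  [~: G^`(1), G] = 1.
Proof.
move=> p_pr p_odd defG /dvdnP[i' ->] /dvdnP[j' ->] cE cp1 cl3.
have [aG bG] : a \in G /\ b \in G by rewrite defG !mem_gen ?set21 ?set22.
have cG' : [~ a, b] \in G^`(1) by rewrite mem_commg.
have cG := subsetP (der_sub 1 G) _ cG'.
have com g z : g \in G -> z \in [~: G^`(1), G] -> commute g z.
  move=> gG zK; apply/commute_sym/(centsP (_ : [~: G^`(1), G] \subset 'C(G))) => //.
  exact/commG1P.
have cab : commute (a ^+ p) b.
  by apply: commute_expg_prime => //; apply: com; rewrite ?mem_commg.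
have cba : commute (b ^+ p) a.
  have baG' : [~ b, a] \in G^`(1) by rewrite mem_commg.
  apply: commute_expg_prime => //; first by rewrite -invg_comm expVgn cp1 invg1.
    by apply: com; rewrite ?mem_commg.
  by apply: com; rewrite ?mem_commg // (subsetP (der_sub 1 G)).
have cc : [~ a, b] \in 'Z(G).
  rewrite inE cG defG cent_gen; apply/centP => g /set2P[] ->; rewrite cE.
    apply/commute_sym/commuteM; first exact: commuteX.
    by rewrite mulnC expgM; apply/commuteX/commute_sym.
  apply/commute_sym/commuteM; last exact: commuteX.
  by rewrite mulnC expgM; apply/commuteX/commute_sym.
have ncG : <[[~ a, b]]> <| G by apply: sub_center_normal; rewrite cycle_subG.
rewrite (der1_gen2 defG ncG); apply/commG1P; rewrite cycle_subG.
by case/setIP: cc.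
Qed.

(** Dividing by [[G', G], G] reduces to [der1_central_of_class3]. So a nontrivial [G', G] would lie
    in its own commutator with G, which nilpotence forbids. *)
Lemma der1_abelem_central gT p (G : {group gT}) (a b : gT) i j :
    prime p -> odd p -> p.-group G -> G :=: <<[set a; b]>> ->
    p %| i -> p %| j -> [~ a, b] = a ^+ i * b ^+ j -> p.-abelem G^`(1) ->
  [~: G^`(1), G] = 1.
Proof.
move=> p_pr p_odd pG defG pi pj cE abG'.
have [aG bG] : a \in G /\ b \in G by rewrite defG !mem_gen ?set21 ?set22.
set L := [~: G^`(1), G]%G; apply/eqP; apply: contraT => ntL.
have nL : L <| G by apply: char_normal; rewrite charR ?der_char ?char_refl.
set N := [~: L, G]%G.
have nN : N <| G by apply: char_normal; rewrite !charR ?der_char ?char_refl.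
have nNG := normal_norm nN; have NG := subsetP nNG.
have nNG' : G^`(1) \subset 'N(N) := subset_trans (der_sub 1 G) nNG.
have nNL : L \subset 'N(N) := subset_trans (normal_sub nL) nNG.
have defGN : G / N = <<[set coset N a; coset N b]>>.
  rewrite {1}defG /= quotient_gen ?subUset ?sub1set ?NG //.
  by rewrite /quotient morphimU !morphim_set1 ?NG.
have sub : L \subset N.
  rewrite -quotient_sub1 // quotientR // quotient_der //.
  rewrite (@der1_central_of_class3 _ p (G / N)%G (coset N a) (coset N b) i j) //.
  - by rewrite -morphR ?NG // cE morphM ?morphX ?NG ?groupX.
  - have [_ cp] := abelemP p_pr abG'.
    by rewrite -morphR -?morphX ?NG ?groupR ?cp ?morph1 ?mem_commg.
  - by rewrite -quotient_der // -!quotientR // trivg_quotient.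
have := nil_comm_properl (pgroup_nil pG) (normal_sub nL) ntL.
move/(_ G); rewrite subsetI subxx (normal_norm nL) => /(_ isT).
by move/proper_subn; rewrite sub.
Qed.

(** Modulo the Frattini subgroup of G', the derived subgroup is elementary abelian, hence central
    and generated by the image of [a, b]. As Frattini elements are non-generators, [a, b] generates
    G' itself. *)
Lemma commg_cycle_normal gT p (G : {group gT}) (a b : gT) i j :
    prime p -> odd p -> p.-group G -> G :=: <<[set a; b]>> ->
    p %| i -> p %| j -> [~ a, b] = a ^+ i * b ^+ j ->
  <[[~ a, b]]> <| G.
Proof.
move=> p_pr p_odd pG defG pi pj cE.
have [aG bG] : a \in G /\ b \in G by rewrite defG !mem_gen ?set21 ?set22.
have pG' : p.-group G^`(1) := pgroupS (der_sub 1 G) pG.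
set V := 'Phi(G^`(1))%G.
have nV : V <| G.
  by apply: char_normal; apply: char_trans (Phi_char _) (der_char 1 G).
have nVG := normal_norm nV; have VG := subsetP nVG.
have defGV : G / V = <<[set coset V a; coset V b]>>.
  rewrite {1}defG /= quotient_gen ?subUset ?sub1set ?VG //.
  by rewrite /quotient morphimU !morphim_set1 ?VG.
have cent : [~: (G / V)^`(1), G / V] = 1.
  apply: (@der1_abelem_central _ p (G / V)%G (coset V a) (coset V b) i j) => //.
  - exact: quotient_pgroup.
  - by rewrite -morphR ?VG // cE morphM ?morphX ?VG ?groupX.
  - by rewrite /= -quotient_der // Phi_quotient_abelem.
have ncV : <[[~ coset V a, coset V b]]> <| G / V.
  apply: sub_center_normal; rewrite cycle_subG inE groupR ?mem_quotient //=.
  by move/commG1P/subsetP: cent; apply; rewrite mem_commg ?mem_quotient.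
have := der1_gen2 defGV ncV; rewrite -quotient_der // -morphR ?VG //.
rewrite -quotient_cycle ?VG ?groupR // => eqV.
suff /Phi_nongen genc : 'Phi(G^`(1)) <*> [set [~ a, b]] = G^`(1).
  by rewrite /cycle genc der_normal.
have cG' : [~ a, b] \in G^`(1) by rewrite mem_commg.
apply/eqP; rewrite eqEsubset join_subG Phi_sub sub1set cG' /=.
rewrite -joing_idr -(@quotientSGK _ V) ?joing_subl //=.
  by rewrite quotientYidl ?eqV // cycle_subG VG // groupR.
exact: subset_trans (der_sub 1 G) nVG.
Qed.

(** * Factorisation of G as a product of two cyclic groups *)

Section Powerful.
Variables (p : nat) (gT : finGroupType) (G : {group gT}) (a b : gT) (i j : nat).
Hypotheses (p_pr : prime p) (p_odd : odd p) (pG : p.-group G).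
Hypothesis defG : G :=: <<[set a; b]>>.
Hypotheses (pi : p %| i) (pj : p %| j) (cE : [~ a, b] = a ^+ i * b ^+ j).

Let aG : a \in G. Proof. by rewrite defG mem_gen ?set21. Qed.
Let bG : b \in G. Proof. by rewrite defG mem_gen ?set22. Qed.
Let nC : <[[~ a, b]]> <| G.
Proof. exact: commg_cycle_normal p_pr p_odd pG defG pi pj cE. Qed.

Lemma powerful_commg x y : x \in G -> y \in G -> [~ x, y] \in <[[~ a, b]]>.
Proof. by move=> xG yG; rewrite -(der1_gen2 defG nC) mem_commg. Qed.

(** Since p | i, the elements a^i and b^j commute modulo [<c^p>], where c = [a, b]. The error in the
    p^k-th power is thus one level deeper than c^(p^k). *)
Lemma powerful_commg_pexp k :
  exists2 z, z \in <[[~ a, b] ^+ (p ^ k.+1)]> &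
    [~ a, b] ^+ (p ^ k) = a ^+ (i * p ^ k) * b ^+ (j * p ^ k) * z.
Proof.
have [aiG bjG] : a ^+ i \in G /\ b ^+ j \in G by rewrite !groupX.
have [|z zw e] :=
  expMg_pexp_cycle k p_pr p_odd pG (cycleX_normal p nC) aiG bjG.
  have [i' ->] := dvdnP pi; rewrite expgM.
  apply: commXg_prime_cycle p_pr p_odd pG nC _ bjG _; rewrite ?groupX //.
  by apply: powerful_commg; rewrite ?groupX.
exists z; first by rewrite expnS expgM.
by rewrite cE e !expgM.
Qed.

Lemma powerful_mulG : <[a]> * <[b]> = G.
Proof.
set c := [~ a, b].
have cG : c \in G by apply: groupR.
(* G = <a><b><c^(p^k)> for all k, since c^(p^k) is the product of a power of a *)
(* and a power of b modulo <c^(p^k.+1)>.                                       *)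
have filt k g : g \in G ->
    exists m n, exists2 z, z \in <[c ^+ (p ^ k)]> & g = a ^+ m * b ^+ n * z.
  elim: k g => [|k IH] g gG.
    have nbc : <[b]> <*> <[c]> <| G.
      apply: sub_der1_normal; first by rewrite (der1_gen2 defG nC) joing_subr.
      by rewrite join_subG !cycle_subG bG.
    have : g \in <[a]> <*> (<[b]> <*> <[c]>).
      move: gG; rewrite {1}defG; apply/subsetP; rewrite gen_subG subUset !sub1set.
      rewrite (subsetP (joing_subl _ _)) ?cycle_id //=.
      by rewrite (subsetP (joing_subr _ _)) // (subsetP (joing_subl _ _)) ?cycle_id.
    rewrite norm_joinEl; last first.
      by rewrite cycle_subG (subsetP (normal_norm nbc)).
    rewrite /= norm_joinEl; last by rewrite cycle_subG (subsetP (normal_norm nC)).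
    case/mulsgP=> _ x /cycleP[m ->] /mulsgP[_ z /cycleP[n ->] zC ->] ->.
    by exists m, n, z; rewrite ?mulgA.
  have [m [n [_ /cycleP[t ->] ->]]] := IH g gG.
  have nW := cycleX_normal (p ^ k.+1) nC; have NW := subsetP (normal_norm nW).
  have nWk := cycleX_normal (p ^ k) nC.
  elim: t => [|t [m' [n' [z' z'W e]]]].
    by exists m, n, 1; rewrite ?group1 // expg0.
  have [z2 z2W e2] := powerful_commg_pexp k.
  set C := c ^+ (p ^ k) in e e2 *.
  have CG : C \in G by apply: groupX.
  have bnG : b ^+ n' \in G by apply: groupX.
  have rW : [~ b ^+ n', C] \in <[c ^+ (p ^ k.+1)]>.
    rewrite -invg_comm groupV expnSr expgM.
    exact: pgroup_commg_cycle p_pr pG nWk bnG.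
  exists (m' + i * p ^ k)%N, (j * p ^ k + n')%N.
  exists (z2 ^ (b ^+ n') * [~ b ^+ n', C] * z' ^ C).
    by apply: groupM; [apply: groupM|]; rewrite ?memJ_norm ?NW.
  rewrite expgSr mulgA e -mulgA (conjgC z' C) !mulgA.
  congr (_ * _); rewrite -(mulgA (a ^+ m')) (commgC (b ^+ n') C) !mulgA.
  congr (_ * _); rewrite -/C in e2; rewrite {1}e2 !expgD !mulgA.
  by rewrite !mulgK.
apply/eqP; rewrite eqEsubset mul_subG ?cycle_subG //=; apply/subsetP => g gG.
have [k ck1] : exists k, c ^+ (p ^ k) = 1.
  have [k e] := p_natP (mem_p_elt pG cG).
  by exists k; rewrite -e expg_order.
have [m [n [z]]] := filt k g gG.
rewrite ck1 cycle1 => /set1P -> ->.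
by rewrite mulg1 mem_mulg ?mem_cycle.
Qed.

End Powerful.

(** * Products of two disjoint cyclic p-groups *)

Lemma cycle_gen_of_mem_der1_joing p gT (H : {group gT}) (x y : gT) :
  p.-group H -> x \in H -> y \in H -> x \in H^`(1) <*> <[y]> ->
  <<[set x; y]>> = H -> <[y]> = H.
Proof.
move=> pH xH yH xy defH; apply: Phi_nongen.
apply/eqP; rewrite eqEsubset join_subG Phi_sub sub1set yH /= -{1}defH.
rewrite gen_subG subUset !sub1set; apply/andP; split; last first.
  by rewrite (subsetP (joing_subr _ _)) ?set11.
apply: subsetP xy; rewrite join_subG (Phi_joing pH) cycle_subG.
rewrite (subset_trans (joing_subl _ _) (joing_subl _ _)) /=.
by rewrite (subsetP (joing_subr _ _)) ?set11.
Qed.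

(** The prescribed order of G encodes the trivial intersection of the two cyclic factors. *)
Definition bicyclic p d e gT (G : {group gT}) (a b : gT) : Prop :=
  [/\ <[a]> * <[b]> = G, #[a] = (p ^ d)%N, #[b] = (p ^ e)%N
    & #|G| = (p ^ (d + e))%N].

Section Bicyclic.
Variables (p d e : nat) (gT : finGroupType) (G : {group gT}) (a b : gT).
Hypotheses (p_pr : prime p) (p_odd : odd p) (abG : bicyclic p d e G a b).

Lemma bicyclic_gen : G :=: <<[set a; b]>>.
Proof.
have [defG _ _ _] := abG; apply/eqP; rewrite eqEsubset; apply/andP; split.
  by rewrite -{1}defG mul_subG /= ?cycle_subG ?mem_gen ?set21 ?set22.
rewrite gen_subG subUset !sub1set -defG; apply/andP; split.
  by rewrite (subsetP (mulG_subl _ _)) ?cycle_id.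
by rewrite (subsetP (mulG_subr _ _)) ?cycle_id.
Qed.

Lemma bicyclic_pgroup : p.-group G.
Proof. by have [_ _ _ oG] := abG; rewrite /pgroup oG pnatX pnat_id. Qed.

Lemma bicyclic_TI : <[a]> :&: <[b]> = 1.
Proof.
have [defG oa ob oG] := abG.
have := mul_cardG <[a]> <[b]>; rewrite -!orderE defG oa ob oG expnD => /eqP.
rewrite -[X in X == _]muln1 eqn_pmul2l ?muln_gt0 ?expn_gt0 ?prime_gt0 //.
by rewrite eq_sym => /eqP/card1_trivg.
Qed.

Lemma bicyclic_expg_eq i i' j j' :
    a ^+ i * b ^+ j = a ^+ i' * b ^+ j' ->
  i = i' %[mod p ^ d] /\ j = j' %[mod p ^ e].
Proof.
move=> eq; have [_ oa ob _] := abG.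
have eq2 : a ^- i' * a ^+ i = b ^+ j' * b ^- j.
  by apply: (canRL (mulgK _)); rewrite -mulgA eq mulKg.
have : a ^- i' * a ^+ i \in <[a]> :&: <[b]>.
  by rewrite inE {2}eq2 !groupM ?groupV ?mem_cycle.
rewrite bicyclic_TI => /set1P eq1; move: eq2; rewrite eq1 => /esym/eqP eq2.
split; apply/eqP; rewrite -?oa -?ob -eq_expg_mod_order.
  by rewrite -(inj_eq (mulgI (a ^- i'))) eq1 mulVg.
by rewrite eq_sym -(inj_eq (mulIg (b ^- j))) mulgV.
Qed.

Let aG : a \in G. Proof. by rewrite bicyclic_gen mem_gen ?set21. Qed.
Let bG : b \in G. Proof. by rewrite bicyclic_gen mem_gen ?set22. Qed.

(** If p did not divide i, then a would be a power of a^i = [a, b] b^-j, an element of G'[<b>]. By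
    the Frattini argument b would generate G, so d = 0 and i = 0, a contradiction. The case of j is
    symmetric. *)
Lemma bicyclic_commg_code :
  exists i j, [/\ (i < p ^ d)%N, (j < p ^ e)%N, p %| i, p %| j
    & [~ a, b] = a ^+ i * b ^+ j].
Proof.
have [defG oa ob oG] := abG; have pG := bicyclic_pgroup.
have : [~ a, b] \in <[a]> * <[b]> by rewrite defG groupR.
case/mulsgP=> _ _ /cyclePmin[i lti ->] /cyclePmin[j ltj ->] cE.
rewrite oa in lti; rewrite ob in ltj; exists i, j; split=> //.
  have [//|ndi] := boolP (p %| i).
  have bE : <[b]> = G.
    apply: (cycle_gen_of_mem_der1_joing pG aG bG _ (esym bicyclic_gen)).
    have /cycleP[k ->] : a \in <[a ^+ i]>.
      have : generator <[a]> (a ^+ i).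
        by rewrite generator_coprime oa coprimeXl // prime_coprime.
      by move/eqP <-; apply: cycle_id.
    rewrite groupX // -(mulgK (b ^+ j) (a ^+ i)) -cE groupM ?groupV //.
      by rewrite (subsetP (joing_subl _ _)) // mem_commg.
    by rewrite (subsetP (joing_subr _ _)) // mem_cycle.
  move: oG; rewrite -bE -orderE ob => /eqP.
  rewrite eqn_exp2l ?prime_gt1 // -{1}(add0n e) eqn_add2r => /eqP d0.
  by move: lti; rewrite -d0 ltnS leqn0 => /eqP i0; rewrite i0 dvdn0 in ndi.
have [//|ndj] := boolP (p %| j).
have aE : <[a]> = G.
  apply: (cycle_gen_of_mem_der1_joing pG bG aG); last by rewrite setUC -bicyclic_gen.
  have /cycleP[k ->] : b \in <[b ^+ j]>.
    have : generator <[b]> (b ^+ j).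
      by rewrite generator_coprime ob coprimeXl // prime_coprime.
    by move/eqP <-; apply: cycle_id.
  rewrite groupX // -(mulKg (a ^+ i) (b ^+ j)) -cE groupM ?groupV //.
    by rewrite (subsetP (joing_subr _ _)) // mem_cycle.
  by rewrite (subsetP (joing_subl _ _)) // mem_commg.
move: oG; rewrite -aE -orderE oa => /eqP.
rewrite eqn_exp2l ?prime_gt1 // -{1}(addn0 d) eqn_add2l => /eqP e0.
by move: ltj; rewrite -e0 ltnS leqn0 => /eqP j0; rewrite j0 dvdn0 in ndj.
Qed.

Section Code.
Variables i j : nat.
Hypotheses (pi : p %| i) (pj : p %| j) (cE : [~ a, b] = a ^+ i * b ^+ j).
Let pG := bicyclic_pgroup.
Let defG := bicyclic_gen.
Let nC : <[[~ a, b]]> <| G.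
Proof. exact: commg_cycle_normal p_pr p_odd pG defG pi pj cE. Qed.

Lemma bicyclic_commg_expg : [~ a, b] ^+ (p ^ d) = 1.
Proof.
have [_ oa _ _] := abG; apply/eqP; rewrite -cycle_eq1.
rewrite -(cycle_commXg_pexp d p_pr p_odd pG aG bG nC).
by rewrite -oa expg_order comm1g cycle1.
Qed.

(** Raising the code to the power p^d kills [a, b], the error term and the power of a, leaving b^(j
    p^d) = 1. *)
Lemma bicyclic_code_dvdn : (p ^ (e - d) %| j)%N.
Proof.
have [_ oa ob _] := abG.
have [z] := powerful_commg_pexp p_pr p_odd pG defG pi pj cE d.
rewrite expnSr expgM bicyclic_commg_expg expg1n cycle1 => /set1P ->.
rewrite mulg1 mulnC expgM -oa expg_order expg1n mul1g => /esym/eqP.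
rewrite -order_dvdn ob oa; case: (leqP d e) => [le_de|/ltnW/eqnP->]; last by rewrite dvd1n.
by rewrite -{1}(subnK le_de) expnD dvdn_pmul2r // expn_gt0 prime_gt0.
Qed.

Lemma bicyclic_order_mul : d <= e -> #[a * b] = (p ^ e)%N.
Proof.
move=> le_de; have [_ oa ob oG] := abG.
have oX (x : gT) n m : #[x] = (p ^ n)%N -> n <= m -> x ^+ (p ^ m) = 1.
  by move=> ox le_nm; apply/eqP; rewrite -order_dvdn ox dvdn_exp2l.
have cw := powerful_commg p_pr p_odd pG defG pi pj cE aG bG.
have cpe : [~ a, b] ^+ (p ^ e) = 1.
  by rewrite -(subnKC le_de) expnD expgM bicyclic_commg_expg expg1n.
have abpe : (a * b) ^+ (p ^ e) = 1.
  have [z] := expMg_pexp_cycle e p_pr p_odd pG nC aG bG cw.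
  rewrite cpe cycle1 => /set1P-> ->.
  by rewrite (oX a d) // (oX b e) // !mulg1.
have /(dvdn_pfactor _ _ p_pr)[m le_me om] : #[a * b] %| p ^ e.
  by rewrite order_dvdn abpe.
have [lt_me|] := ltnP m e; last first.
  by move=> le_em; rewrite om; congr (_ ^ _)%N; apply/eqP; rewrite eqn_leq le_me.
have [e' eE] : exists e', e = e'.+1.
  by case: (e) lt_me => [|e'] // _; exists e'.
rewrite eE in le_de ob cpe lt_me.
(* Already at level e' = e - 1 the commutator dies, because p divides i and j. Then (ab)^(p^e') = 1
   would force b^(p^e') = 1, against the order of b. *)
have cpe' : [~ a, b] ^+ (p ^ e') = 1.
  have [z] := powerful_commg_pexp p_pr p_odd pG defG pi pj cE e'.
  rewrite cpe cycle1 => /set1P-> ->; have [i' ->] := dvdnP pi; have [j' ->] := dvdnP pj.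
  rewrite -!mulnA -expnS ![(_ * p ^ _)%N]mulnC !expgM.
  by rewrite (oX a d) // (oX b e'.+1) // !expg1n !mulg1.
have [z] := expMg_pexp_cycle e' p_pr p_odd pG nC aG bG cw.
rewrite cpe' cycle1 => /set1P->; rewrite (oX _ m) // mulg1 => /esym ab1.
have [|_] := @bicyclic_expg_eq (p ^ e') 0 (p ^ e') 0; first by rewrite ab1 mulg1.
by rewrite mod0n modn_small ?ltn_exp2l ?prime_gt1 ?eE // => /eqP;
  rewrite expn_eq0 gtn_eqF // prime_gt0.
Qed.

End Code.
End Bicyclic.

(** With q = p^d, the divisibility of j removes b from the expansion of [a, b]^q, so [a, b]^q lies
    in [<a^q>]. Since [a^q, b] is a power of [a, b]^q, b normalises [<a^q>]. *)
Lemma bicyclic_cycleX_normal p d e gT (G : {group gT}) (a b : gT) i j :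
    prime p -> odd p -> bicyclic p e e G a b -> p %| i -> p %| j ->
    (p ^ (e - d) %| j)%N -> d <= e -> [~ a, b] = a ^+ i * b ^+ j ->
  <[a ^+ (p ^ d)]> <| G.
Proof.
move=> p_pr p_odd abG pi pj pej le_de cE.
have [_ oa ob _] := abG; have pG := bicyclic_pgroup p_pr abG.
have defG := bicyclic_gen abG.
have nC := commg_cycle_normal p_pr p_odd pG defG pi pj cE.
have [aG bG] : a \in G /\ b \in G by rewrite defG !mem_gen ?set21 ?set22.
set q := (p ^ d)%N.
have cqa : [~ a, b] ^+ q \in <[a ^+ q]>.
  have [z zw] := powerful_commg_pexp p_pr p_odd pG defG pi pj cE d.
  have -> : b ^+ (j * p ^ d) = 1.
    apply/eqP; rewrite -order_dvdn ob -(subnK le_de) expnD.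
    by rewrite dvdn_pmul2r // expn_gt0 prime_gt0.
  move/(canLR (mulgK z)); rewrite mulg1 -/q => eq.
  have : z^-1 \in <[[~ a, b] ^+ q ^+ p]> by rewrite groupV -expgM -expnSr.
  case/cycleP=> k zE; move: eq; rewrite zE => eq.
  rewrite -cycle_subG -(@cycle_expg_1mod p _ _ k p_pr).
    by rewrite expgD expg1 (expgM _ p k) eq cycle_subG mulnC expgM mem_cycle.
  by apply: mem_p_elt pG _; rewrite groupX ?groupR.
rewrite /normal cycle_subG groupX //= {1}defG gen_subG subUset !sub1set.
apply/andP; split; rewrite inE -cycleJ cycle_subG.
  by rewrite conjXg /conjg mulKg cycle_id.
rewrite conjg_mulR groupM ?cycle_id //.
have : [~ a ^+ q, b] \in <[[~ a, b] ^+ q]>.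
  by apply: (commXg_pexp_cycle d p_pr p_odd pG nC aG bG); apply: cycle_id.
by apply/subsetP; rewrite cycle_subG.
Qed.

End PGroups.

(** * A p-adic fixed-point equation *)

Section FixedPoint.
Import GRing.Theory.
Local Open Scope ring_scope.

Lemma dvdz_expn_sub1 (p : nat) (x : int) n :
  (p %| x - 1)%Z -> (p %| x ^+ n - 1)%Z.
Proof.
by move=> px; rewrite subrX1 dvdz_mulr.
Qed.

(** Linearisation with one extra p-adic digit: at points congruent to 1, the n-th power map has
    derivative n modulo p. *)
Lemma dvdz_expn_linear (p k : nat) (x y : int) (n : nat) :
    (p %| x - 1)%Z -> ((p ^ k.+1)%N %| y - x)%Z ->
  ((p ^ k.+2)%N %| y ^+ n - x ^+ n - n%:R * (y - x))%Z.
Proof.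
move=> px pyx.
have py : (p %| y - 1)%Z.
  rewrite -(subrK x y) -addrA rpredD //; apply: dvdz_trans pyx.
  by rewrite expnS PoszM dvdz_mulr.
elim: n => [|n IH]; first by rewrite !expr0 mul0r !subrr dvdz0.
have -> : y ^+ n.+1 - x ^+ n.+1 - n.+1%:R * (y - x) =
   y * (y ^+ n - x ^+ n - n%:R * (y - x)) + (y - x) * (x ^+ n - 1)
   + n%:R * ((y - x) * (y - 1)).
  by rewrite !exprS -natr1; ring.
have pM z : (p %| z)%Z -> ((p ^ k.+2)%N %| (y - x) * z)%Z.
  by move=> pz; rewrite expnSr PoszM dvdz_mul.
apply: rpredD; [apply: rpredD|]; first exact: dvdz_mull.
  exact/pM/dvdz_expn_sub1.
exact/dvdz_mull/pM.
Qed.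

Lemma dvdz_expn_pexp_sub1 (p e : nat) (x : int) :
  (p %| x - 1)%Z -> ((p ^ e.+1)%N %| x ^+ (p ^ e) - 1)%Z.
Proof.
move=> px; elim: e => [|e IH]; first by rewrite expr1 expn1.
have := dvdz_expn_linear (k := e) (x := 1) p _ IH; rewrite subrr dvdz0 expr1n.
rewrite -exprM -expnSr => /(_ isT) dvd.
rewrite -(subrK (p%:R * (x ^+ (p ^ e) - 1)) (x ^+ _ - 1)) rpredD //.
by rewrite expnS PoszM dvdz_mul // natz.
Qed.

Lemma expn_1mod_pexp p e L :
  L = 1 %[mod p] -> L ^ (p ^ e) = 1 %[mod p ^ e.+1].
Proof.
move=> /eqP; rewrite -eqz_nat -!modz_nat eqz_mod_dvd => /(dvdz_expn_pexp_sub1 e) L1.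
by apply/eqP; rewrite -eqz_nat -!modz_nat eqz_mod_dvd -natz natrX natz.
Qed.

(* The map L |-> 1 + \sum_(t < i) L ^ (m + b t) is a p-adic contraction of     *)
(* 1 + p Z_p, because p divides the sum of the exponents.                      *)
Lemma geometric_fixed_point (p i m b k : nat) : prime p -> odd p -> (p %| i)%N ->
  exists L, L = 1 %[mod p] /\
    L = (1 + \sum_(t < i) L ^ (m + b * t))%N %[mod p ^ k].
Proof.
move=> p_pr p_odd pi.
pose F L := (1 + \sum_(t < i) L ^ (m + b * t))%N.
have FE (x : nat) : (F x)%:Z = 1 + \sum_(t < i) x%:Z ^+ (m + b * t).
  rewrite /F PoszD -!natz natr_sum; congr (_ + _).
  by apply: eq_bigr => t _; rewrite natrX.
suff [L [L1 LF]] : exists L, (p %| L%:Z - 1)%Z /\ ((p ^ k.+1)%N %| (F L)%:Z - L%:Z)%Z.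
  exists L; split; apply/eqP; first by rewrite -eqz_nat -!modz_nat eqz_mod_dvd.
  rewrite eq_sym -eqz_nat -!modz_nat eqz_mod_dvd; apply: dvdz_trans LF.
  by rewrite expnS PoszM dvdz_mull.
(* Modulo p this sum is the derivative of F. Its second part is b times i(i-1)/2, divisible by p
   because p is odd. *)
have ex : (p %| (\sum_(t < i) (m + b * t)))%N.
  rewrite big_split /= sum_nat_const card_ord -big_distrr /=.
  apply: dvdn_add; [exact: dvdn_mulr | apply: dvdn_mull].
  rewrite -(big_mkord xpredT id) bin2_sum.
  have : (p %| 2 * 'C(i, 2))%N by rewrite -mul_bin_diag dvdn_mulr.
  by rewrite Gauss_dvdr // coprimen2.
elim: k => [|k [L [L1 LF]]].
  exists 1%N; rewrite subrr dvdz0 /F; split=> //.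
  rewrite (eq_bigr (fun=> 1%N)) => [|t _]; last by rewrite exp1n.
  by rewrite sum_nat_const card_ord muln1 PoszD addrAC subrr add0r expn1.
exists (F L); split.
  rewrite -(subrK L%:Z (F L)%:Z) -addrA rpredD //; apply: dvdz_trans LF.
  by rewrite expnS PoszM dvdz_mulr.
(* Each term is replaced by its linear part. The linear parts add up to the exponent sum times F L -
   L, which gains the next factor p. *)
have -> : (F (F L))%:Z - (F L)%:Z =
  \sum_(t < i) ((F L)%:Z ^+ (m + b * t) - L%:Z ^+ (m + b * t)
     - (m + b * t)%:R * ((F L)%:Z - L%:Z))
  + (\sum_(t < i) (m + b * t))%:R * ((F L)%:Z - L%:Z).
  rewrite !sumrB natr_sum -mulr_suml subrK.
  by rewrite FE [X in _ - X = _]FE opprD addrACA subrr add0r.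
apply: rpredD; first by apply: rpred_sum => t _; apply: dvdz_expn_linear.
by rewrite expnS PoszM dvdz_mul // natz.
Qed.
End FixedPoint.

(** * Existence of bicyclic p-groups *)

Section Realization.
Import GroupScope.

(** The split extension acts on pairs over Z_n: h translates the first coordinate, while b scales it
    by L and shifts the second. The shift gives b order exactly n even if L has smaller
    multiplicative order. *)
Lemma holomorph_pair n L : 1 < n -> coprime n L -> L ^ n = 1 %[mod n] ->
  exists (gT : finGroupType) (h b : gT),
    [/\ #[h] = n, #[b] = n, <[h]> :&: <[b]> = 1 & h ^ b = h ^+ L].
Proof.
move=> n1 cL Ln; pose R := 'Z_n.
have Lu : (L%:R : R)%R \is a GRing.unit by rewrite unitZpE.
pose hf (u : R * R) := ((u.1 + 1)%R, u.2).
pose bf (u : R * R) := ((L%:R * u.1)%R, (u.2 + 1)%R).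
have hfI : injective hf.
  move=> [x y] [x' y'] e; have ey : y = y' := congr1 snd e.
  by have ex : x = x' := GRing.addIr _ (congr1 fst e); rewrite ex ey.
have bfI : injective bf.
  move=> [x y] [x' y'] e.
  have ex : x = x' := GRing.mulrI Lu (congr1 fst e).
  by have ey : y = y' := GRing.addIr _ (congr1 snd e); rewrite ex ey.
pose h := perm hfI; pose b := perm bfI.
have hX k u : (h ^+ k) u = ((u.1 + k%:R)%R, u.2).
  elim: k u => [|k IH] [x y]; first by rewrite perm1 /= GRing.addr0.
  by rewrite expgS permM IH permE /= -GRing.addrA GRing.nat1r.
have bX k u : (b ^+ k) u = (((L ^ k)%:R * u.1)%R, (u.2 + k%:R)%R).
  elim: k u => [|k IH] [x y]; first by rewrite perm1 /= GRing.mul1r GRing.addr0.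
  rewrite expgS permM IH permE /= GRing.mulrA -GRing.natrM -GRing.addrA GRing.nat1r.
  by rewrite -expnSr.
have nat0 k : ((k%:R : R) == 0)%R = (n %| k).
  by rewrite -(inj_eq val_inj) /= val_Zp_nat.
have order_eq (g : {perm (R * R)}) : g ^+ n = 1 -> (forall k, g ^+ k = 1 -> n %| k) -> #[g] = n.
  move=> gn gk; apply/eqP; rewrite eqn_dvd order_dvdn gn eqxx /=.
  by apply: gk; apply: expg_order.
exists {perm (R * R)}, h, b; split.
- apply: order_eq => [|k /permP/(_ (0, 0)%R)].
    apply/permP => -[x y]; rewrite hX perm1 /=; congr (_, _).
    by have /eqP -> : (n%:R == 0 :> R)%R; rewrite ?nat0 // GRing.addr0.
  by rewrite hX perm1 /= GRing.add0r => /(congr1 fst)/= /eqP; rewrite nat0.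
- apply: order_eq => [|k /permP/(_ (0, 0)%R)].
    apply/permP => -[x y]; rewrite bX perm1 /=; congr (_, _); last first.
      by have /eqP -> : (n%:R == 0 :> R)%R; rewrite ?nat0 // GRing.addr0.
    by rewrite -(Zp_nat_mod n1) Ln modn_small // GRing.mul1r.
  by rewrite bX perm1 /= GRing.add0r => /(congr1 snd)/= /eqP; rewrite nat0.
- apply/trivgP/subsetP => _ /setIP[/cycleP[k ->] /cycleP[l]].
  move/permP/(_ (0, 0)%R); rewrite hX bX /= GRing.mulr0 GRing.add0r => /(congr1 fst)/= k0.
  by apply/set1P/permP => -[x y]; rewrite hX perm1 /= k0 GRing.addr0.
apply: (mulgI b); rewrite -conjgC; apply/permP => -[x y].
have e : (L%:R * ((x : R) + 1) = L%:R * x + L%:R)%R.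
  by rewrite GRing.mulrDr GRing.mulr1.
rewrite !permM hX !permE; exact: (congr1 (fun z => (z, (y + 1)%R)) e).
Qed.

(** * Prescribing the commutator in a metacyclic group *)

Section Metacyclic.
Variables (gT : finGroupType) (h b : gT) (L : nat).
Hypothesis hb : h ^ b = h ^+ L.

Lemma metacyclic_conjX m k : (h ^+ m) ^ (b ^+ k) = h ^+ (m * L ^ k).
Proof.
elim: k => [|k IH]; first by rewrite conjg1 muln1.
by rewrite expgSr conjgM IH conjXg hb -expgM expnS mulnCA.
Qed.

Lemma metacyclic_expMg B t :
  (h * b ^+ B) ^+ t = b ^+ (B * t) * h ^+ (\sum_(s < t) L ^ (B * s.+1)).
Proof.
elim: t => [|t IH]; first by rewrite big_ord0 muln0 mulg1.
rewrite expgSr IH -mulgA (mulgA (h ^+ _)) -expgSr (conjgC (h ^+ _)).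
rewrite metacyclic_conjX mulgA -expgD mulnS addnC; congr (_ * h ^+ _).
rewrite big_ord_recl /= muln1 mulSn; congr (_ + _)%N.
rewrite big_distrl; apply: eq_bigr => s _ /=.
by rewrite -expnD [(B * s.+2)%N]mulnS addnC.
Qed.

(** Once b^(Bi+j) = 1 is used, both sides are conjugates by b^B of powers of h. Equating these
    powers is the fixed-point equation for L. *)
Lemma metacyclic_commg B i j :
    h ^+ L = h ^+ (1 + \sum_(t < i) L ^ (j + B * t)) -> b ^+ (B * i + j) = 1 ->
  [~ h * b ^+ B, b] = (h * b ^+ B) ^+ i * b ^+ j.
Proof.
move=> hL bij; rewrite metacyclic_expMg -mulgA (conjgC (h ^+ _)) metacyclic_conjX.
rewrite mulgA -expgD bij mul1g commgEl conjMg hb hL expgD expg1.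
rewrite invMg -mulgA -(mulgA h) mulKg.
rewrite (_ : (b ^+ B) ^ b = b ^+ B); last by rewrite conjXg /conjg mulKg.
rewrite (conjgC (h ^+ _)) mulKg metacyclic_conjX; congr (h ^+ _).
rewrite !big_distrl; apply: eq_bigr => t _ /=.
by rewrite -!expnD mulnS addnC -addnA (addnC j).
Qed.

End Metacyclic.

Lemma bicyclic_exists_square p e i j B : prime p -> odd p -> 0 < e ->
    p %| i -> p %| j -> (p ^ e %| B * i + j)%N ->
  exists (gT : finGroupType) (G : {group gT}) (a b : gT),
    bicyclic p e e G a b /\ [~ a, b] = a ^+ i * b ^+ j.
Proof.
move=> p_pr p_odd e0 pi pj pBij.
have n1 : (1 < p ^ e)%N by rewrite -(expn0 p) ltn_exp2l ?prime_gt1.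
have [L [L1 LF]] := geometric_fixed_point j B e p_pr p_odd pi.
have cL : coprime (p ^ e) L.
  by rewrite coprimeXl // -coprime_modr L1 coprime_modr coprimen1.
have Ln : L ^ (p ^ e) = 1 %[mod p ^ e].
  have := expn_1mod_pexp e L1 => /eqP; rewrite eqn_mod_dvd; last first.
    by rewrite expn_gt0; case: (L) cL => //; rewrite /coprime gcdn0 gtn_eqF.
  move=> dv; apply/eqP; rewrite eqn_mod_dvd.
    by apply: dvdn_trans dv; rewrite expnS dvdn_mull.
  by rewrite expn_gt0; case: (L) cL => //; rewrite /coprime gcdn0 gtn_eqF.
have [gT [h [b [oh ob ti hb]]]] := holomorph_pair n1 cL Ln.
have nhb : <[b]> \subset 'N(<[h]>).
  by rewrite cycle_subG inE -cycleJ hb cycle_subG mem_cycle.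
pose G := (<[h]> <*> <[b]>)%G; pose a := h * b ^+ B.
have GE : G = <[h]> * <[b]> :> {set gT} by rewrite /= norm_joinEr.
have oG : #|G| = (p ^ (e + e))%N by rewrite GE TI_cardMg // -!orderE oh ob expnD.
have pG : p.-group G by rewrite /pgroup oG pnatX pnat_id.
have nhG : <[h]> <| G.
  by rewrite /normal joing_subl join_subG normG.
have [hG bG] : h \in G /\ b \in G.
  by rewrite (subsetP (joing_subl _ _)) ?cycle_id ?(subsetP (joing_subr _ _)) ?cycle_id.
have aG : a \in G by rewrite groupM ?groupX.
have defG : G :=: <<[set a; b]>>.
  apply/eqP; rewrite eqEsubset join_subG !cycle_subG gen_subG subUset !sub1set aG bG.
  rewrite andbT [b \in _]mem_gen ?set22 // andbT -(mulgK (b ^+ B) h).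
  by rewrite groupM ?groupV ?groupX ?mem_gen ?set21 ?set22.
have cE : [~ a, b] = a ^+ i * b ^+ j.
  apply: (metacyclic_commg hb); last by apply/eqP; rewrite -order_dvdn ob.
  by apply/eqP; rewrite eq_expg_mod_order oh; apply/eqP.
have abG := powerful_mulG p_pr p_odd pG defG pi pj cE.
exists gT, G, a, b; split=> //; split=> //; apply/eqP; rewrite eqn_leq.
(* This bounds the order of a from above; the cardinality of [<a><b>] = G bounds it from below. *)
have an : a ^+ (p ^ e) = 1.
  have [|z] := expMg_pexp_cycle e p_pr p_odd pG nhG hG (groupX B bG).
    by apply: mem_commg_cycle nhG _ _; rewrite ?cycle_id ?groupX.
  rewrite -[X in h ^+ X]oh expg_order cycle1 => /set1P-> ->.
  by rewrite -expgM mulnC expgM -ob expg_order expg1n !mulg1.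
rewrite dvdn_leq ?expn_gt0 ?prime_gt0 ?order_dvdn ?an //=.
have := mul_cardG <[a]> <[b]>; rewrite -!orderE abG oG ob expnD => eq.
rewrite -(leq_pmul2r (_ : 0 < p ^ e)%N) ?expn_gt0 ?prime_gt0 // eq.
by rewrite leq_pmulr ?cardG_gt0.
Qed.

Lemma dvdn_mul_add n i j : 0 < n -> gcdn i n %| j ->
  exists B, (n %| B * i + j)%N.
Proof.
move=> n0; have [->|i0] := posnP i.
  by rewrite gcd0n => nj; exists 0; rewrite mul0n.
case: (egcdnP n i0) => u v uv _ /dvdnP[q ->].
(* A Bezout coefficient scaled by -q, with [n.-1] standing for -1 modulo n. *)
exists (u * q * n.-1)%N.
have -> : (u * q * n.-1 * i + q * gcdn i n = n * (q * (v * n.-1 + gcdn i n)))%N.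
  have -> : (u * q * n.-1 * i = q * n.-1 * (u * i))%N by nia.
  rewrite uv; move: (gcdn i n) => g; case: (n) n0 => // m _ /=; nia.
exact: dvdn_mulr.
Qed.

Lemma bicyclic_sym p d e (gT : finGroupType) (G : {group gT}) (a b : gT) :
  bicyclic p d e G a b -> bicyclic p e d G b a.
Proof.
case=> defG oa ob oG; split=> //; last by rewrite addnC.
have /comm_group_setP <- // : group_set (<[a]> * <[b]>) by rewrite defG groupP.
Qed.

Lemma expg_pred_mul (gT : finGroupType) (x : gT) n k :
  x ^+ n = 1 -> 0 < n -> x ^- (n.-1 * k) = x ^+ k.
Proof.
move=> xn n0; apply/eqP; rewrite eq_invg_mul -expgD -mulSnr prednK //.
by rewrite expgM xn expg1n.
Qed.

Lemma bicyclic_exists p d e i j : prime p -> odd p -> d <= e ->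
    p %| i -> p %| j -> (p ^ (e - d) %| j)%N ->
  exists (gT : finGroupType) (G : {group gT}) (a b : gT),
    bicyclic p d e G a b /\ [~ a, b] = a ^+ i * b ^+ j.
Proof.
move=> p_pr p_odd le_de pi pj pej.
have [e0|e0] := posnP e.
  exists (perm_type void), 1%G, 1, 1.
  have -> : d = 0%N by apply/eqP; rewrite -leqn0 -e0.
  rewrite /bicyclic e0 cycle1 mulg1 order1 cards1 /= comm1g !expg1n mulg1.
  by [].
have n0 : (0 < p ^ e)%N by rewrite expn_gt0 prime_gt0.
have [gT [G [a [b [abG cE]]]]] : exists (gT : finGroupType) (G : {group gT}) (a b : gT),
    bicyclic p e e G a b /\ [~ a, b] = a ^+ i * b ^+ j.
  (* B i + j = 0 modulo p^e is solvable in B when the p-part of i divides that of j. Otherwise a and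
     b are exchanged, turning the code into (-j, -i). *)
  have [u _ uE] := dvdn_pfactor _ _ p_pr (dvdn_gcdr i (p ^ e)).
  have [v _ vE] := dvdn_pfactor _ _ p_pr (dvdn_gcdr j (p ^ e)).
  have [uv|/ltnW vu] := leqP u v.
    have [|B BP] := @dvdn_mul_add (p ^ e) i j n0.
      by rewrite uE (dvdn_trans (dvdn_exp2l p uv)) // -vE dvdn_gcdl.
    exact: bicyclic_exists_square BP.
  have [|B BP] := @dvdn_mul_add (p ^ e) j i n0.
    by rewrite vE (dvdn_trans (dvdn_exp2l p vu)) // -uE dvdn_gcdl.
  have [|||gT [G [a [b [abG cE]]]]] := @bicyclic_exists_square p e
    ((p ^ e).-1 * j) ((p ^ e).-1 * i) B p_pr p_odd e0.
  - exact: dvdn_mull.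
  - exact: dvdn_mull.
  - by rewrite mulnCA -mulnDr dvdn_mull.
  exists gT, G, b, a; split; first exact: bicyclic_sym.
  have [_ oa ob _] := abG.
  have [an bn] : a ^+ (p ^ e) = 1 /\ b ^+ (p ^ e) = 1 by rewrite -{1}oa -ob !expg_order.
  by rewrite -invg_comm cE invMg (expg_pred_mul _ an n0) (expg_pred_mul _ bn n0).
have [defG oa ob oG] := abG; have pG := bicyclic_pgroup p_pr abG.
have nN := bicyclic_cycleX_normal p_pr p_odd abG pi pj pej le_de cE.
set N := <[a ^+ (p ^ d)]>%G in nN; have NG := subsetP (normal_norm nN).
have [aG bG] : a \in G /\ b \in G.
  by rewrite (bicyclic_gen abG) !mem_gen ?set21 ?set22.
have [aN bN] := (NG _ aG, NG _ bG).
exists (coset_of N), (G / N)%G, (coset N a), (coset N b).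
have defQ : <[coset N a]> * <[coset N b]> = G / N.
  by rewrite -!quotient_cycle // -quotientMl ?defG // cycle_subG.
have oQ : #|G / N| = (p ^ (d + e))%N.
  rewrite card_quotient ?normal_norm // -divgS ?normal_sub //= oG -orderE.
  rewrite (orderXexp _ oa) (_ : (e + e = d + e + (e - d))%N); last by lia.
  by rewrite expnD mulnK // expn_gt0 prime_gt0.
split; last by rewrite -morphR // cE morphM ?morphX ?groupX // NG // groupX.
have oa' : #[coset N a] <= p ^ d.
  rewrite dvdn_leq ?expn_gt0 ?prime_gt0 // order_dvdn -morphX //.
  exact/eqP/coset_id/cycle_id.
have ob' : #[coset N b] <= p ^ e.
  by rewrite dvdn_leq // -ob order_dvdn -morphX // expg_order morph1.
(* The images have orders at most p^d and p^e, while the order of the quotient requires their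
   product to be at least p^(d+e). *)
have := mul_cardG <[coset N a]> <[coset N b]>; rewrite -!orderE defQ oQ expnD => eq.
have ge : p ^ d * p ^ e <= #[coset N a] * #[coset N b].
  by rewrite eq leq_pmulr // cardG_gt0.
have pd0 : (0 < p ^ d)%N by rewrite expn_gt0 prime_gt0.
split=> //; apply/eqP; rewrite eqn_leq.
  by rewrite oa' -(leq_pmul2r n0) (leq_trans ge) // leq_mul2l ob' orbT.
by rewrite ob' -(leq_pmul2l pd0) (leq_trans ge) // leq_mul2r oa' orbT.
Qed.

End Realization.

(** * Regular dessins and their monodromy groups *)

Section Dessins.
Import GroupScope.
Implicit Types D : dessin.

Definition monodromy D : {group {perm edge D}} :=
  <<[set rotb D; rotw D]>>%G.

Lemma rotb_monodromy D : rotb D \in monodromy D.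
Proof. by rewrite mem_gen ?set21. Qed.

Lemma rotw_monodromy D : rotw D \in monodromy D.
Proof. by rewrite mem_gen ?set22. Qed.

Lemma monodromy_trans D (x y : edge D) :
  exists2 g, g \in monodromy D & g x = y.
Proof.
have := atransP (dessin_connected D) x (in_setT x) => orb.
have : y \in orbit 'P (monodromy D) x by rewrite orb in_setT.
by case/orbitP=> g gG <-; exists g.
Qed.

(** Automorphisms commute with the monodromy group and carry the fixed edge to every other edge. *)
Lemma monodromy_semiregular D (g : {perm edge D}) x :
  regular D -> g \in monodromy D -> g x = x -> g = 1.
Proof.
move=> regD gG gx; apply/permP => y; rewrite perm1.
have [f [_ fb fw] <-] := regD x y.
have : f \in 'C(monodromy D).
  by rewrite cent_gen; apply/centP => h /set2P[] ->; apply/permP => z; rewrite !permM.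
by move/centP/(_ _ gG)/permP/(_ x); rewrite !permM gx => ->.
Qed.

Lemma card_monodromy D : regular D -> #|monodromy D| = #|edge D|.
Proof.
move=> regD; have [x _ _] := imsetP (dessin_connected D).
have orb := atransP (dessin_connected D) x (in_setT x).
rewrite -(card_orbit_stab 'P (monodromy D) x) orb cardsT.
rewrite (_ : 'C_(_)[x | _] = 1) ?cards1 ?muln1 //.
apply/trivgP/subsetP => g /setIP[gG /astab1P gx].
by apply/set1P; apply: (monodromy_semiregular regD gG gx).
Qed.

Lemma card_porbit_regular D (s : {perm edge D}) x :
  regular D -> s \in monodromy D -> #|porbit s x| = #[s].
Proof.
move=> regD sG; rewrite porbit.unlock card_in_imset // => g h gs hs eq.
have sub : <[s]> \subset monodromy D by rewrite cycle_subG.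
have : g * h^-1 = 1.
  apply: (@monodromy_semiregular D _ x regD).
    by rewrite groupM ?groupV ?(subsetP sub).
  by rewrite permM; move: eq; rewrite /aperm => ->; rewrite permK.
by move/eqP; rewrite -eq_mulgV1 => /eqP.
Qed.

Lemma card_porbits_regular D (s : {perm edge D}) :
  regular D -> s \in monodromy D -> (#|porbits s| * #[s])%N = #|edge D|.
Proof.
move=> regD sG; rewrite -[RHS]cardsT; apply/esym.
apply: card_uniform_partition; first by move=> _ /imsetP[x _ ->]; apply: card_porbit_regular.
have -> : porbits s = orbit 'P <[s]> @: [set: edge D].
  by rewrite /porbits porbitE; apply/setP => A; apply/imsetP/imsetP => -[x _ ->]; exists x.
by apply: orbit_partition; apply/actsP => g _ x; rewrite !inE.
Qed.

Lemma porbitP D (s : {perm edge D}) x y :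
  reflect (exists n, y = (s ^+ n) x) (y \in porbit s x).
Proof.
rewrite porbit.unlock; apply: (iffP imsetP) => [[_ /cycleP[n ->] ->]|[n ->]].
  by exists n.
by exists (s ^+ n); rewrite ?mem_cycle.
Qed.

(* Every black vertex has one edge to each white vertex, so p ^ d is the       *)
(* valency of the black vertices.                                              *)
Definition regular_K p d e D : Prop :=
  [/\ regular D, #|black D| = (p ^ e)%N, #|white D| = (p ^ d)%N &
      forall B W, B \in black D -> W \in white D -> #|B :&: W| = 1%N].

Lemma black_porbit D x : porbit (rotb D) x \in black D.
Proof. exact: imset_f. Qed.

Lemma white_porbit D x : porbit (rotw D) x \in white D.
Proof. exact: imset_f. Qed.

(** * Regular embeddings of K_(p^d, p^e) as bicyclic groups *)

Section RegularK.
Variables (p d e : nat) (D : dessin).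
Hypotheses (p_pr : prime p) (KD : regular_K p d e D).

Lemma regular_K_edge_unique x y y' z :
    y \in porbit (rotb D) x -> y \in porbit (rotw D) z ->
    y' \in porbit (rotb D) x -> y' \in porbit (rotw D) z -> y = y'.
Proof.
have [_ _ _ int] := KD => bx wz b'x w'z.
have /eqP/cards1P[t tE] := int _ _ (black_porbit x) (white_porbit z).
have /set1P -> : y \in [set t] by rewrite -tE inE bx.
by have /set1P -> : y' \in [set t] by rewrite -tE inE b'x.
Qed.

Lemma card_edge_regular_K : #|edge D| = (p ^ (d + e))%N.
Proof.
have [_ cb cw int] := KD; rewrite addnC expnD -cb -cw -cardsX.
pose f x := (porbit (rotb D) x, porbit (rotw D) x).
rewrite -[LHS]cardsT -(card_imset _ (_ : injective f)).
  congr #|pred_of_set _|; apply/setP => -[B W]; rewrite inE /=.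
  apply/imsetP/andP => [[x _ [-> ->]]|[]]; first by rewrite black_porbit white_porbit.
  move=> bB wW; have /eqP/cards1P[t tE] := int _ _ bB wW.
  have /setIP[tB tW] : t \in B :&: W by rewrite tE set11.
  exists t => //; congr (_, _).
    by case/imsetP: bB tB => x _ ->; rewrite -eq_porbit_mem => /eqP ->.
  by case/imsetP: wW tW => x _ ->; rewrite -eq_porbit_mem => /eqP ->.
move=> x y [ex ey]; apply: (@regular_K_edge_unique y x y y); rewrite -?ex -?ey ?porbit_id //.
  by rewrite ex porbit_id.
by rewrite ey porbit_id.
Qed.

Lemma bicyclic_monodromy : bicyclic p d e (monodromy D) (rotb D) (rotw D).
Proof.
have [regD cb cw _] := KD.
have [bG wG] := (rotb_monodromy D, rotw_monodromy D).
have oG := card_monodromy regD; rewrite card_edge_regular_K in oG.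
have oE := card_edge_regular_K.
have ob : #[rotb D] = (p ^ d)%N.
  have := card_porbits_regular regD bG; rewrite -/(black D) cb oE addnC expnD => /eqP.
  by rewrite eqn_pmul2l ?expn_gt0 ?prime_gt0 // => /eqP.
have ow : #[rotw D] = (p ^ e)%N.
  have := card_porbits_regular regD wG; rewrite -/(white D) cw oE expnD => /eqP.
  by rewrite eqn_pmul2l ?expn_gt0 ?prime_gt0 // => /eqP.
(* A common element moves an edge within both its black and its white vertex, and only one edge
   joins these. *)
have ti : <[rotb D]> :&: <[rotw D]> = 1.
  apply/trivgP/subsetP => g /setIP[gb gw]; apply/set1P.
  have [x _ _] := imsetP (dessin_connected D).
  apply: (@monodromy_semiregular D g x regD).
    by apply: subsetP gb; rewrite cycle_subG.
  case/cycleP: gb => m gb; case/cycleP: gw => n gw.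
  apply: (@regular_K_edge_unique x _ _ x); rewrite ?porbit_id //.
    by rewrite gb mem_porbit.
  by rewrite gw mem_porbit.
split=> //; apply/eqP; rewrite eqEcard mul_subG ?cycle_subG //=.
by rewrite TI_cardMg // -!orderE ob ow oG expnD.
Qed.

End RegularK.

(** The factorisation of G provides an edge between any black and any white vertex; uniqueness of
    exponents shows there is only one. *)
Lemma regular_K_of_bicyclic p d e D : prime p -> regular D ->
  bicyclic p d e (monodromy D) (rotb D) (rotw D) -> regular_K p d e D.
Proof.
move=> p_pr regD abG; have [defG ob ow oG] := abG.
have [bG wG] := (rotb_monodromy D, rotw_monodromy D).
have oE : #|edge D| = (p ^ (d + e))%N by rewrite -card_monodromy.
split=> //.
- have := card_porbits_regular regD bG; rewrite -/(black D) ob oE addnC expnD => /eqP.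
  by rewrite eqn_pmul2r ?expn_gt0 ?prime_gt0 // => /eqP.
- have := card_porbits_regular regD wG; rewrite -/(white D) ow oE expnD => /eqP.
  by rewrite eqn_pmul2r ?expn_gt0 ?prime_gt0 // => /eqP.
move=> _ _ /imsetP[x _ ->] /imsetP[y _ ->].
have [g gG gxy] := monodromy_trans x y.
move: gG; rewrite -defG => /mulsgP[_ _ /cycleP[m ->] /cycleP[n ->] gE].
apply/eqP/cards1P; exists ((rotb D ^+ m) x); apply/setP => z; rewrite !inE.
apply/andP/eqP => [[/porbitP[i zx] /porbitP[j zy]]|->].
  have eq : (rotb D ^+ i) x = (rotb D ^+ m * rotw D ^+ (n + j)) x.
    by rewrite -zx zy -gxy gE !permM expgD permM.
  have : rotb D ^+ m * rotw D ^+ (n + j) * rotb D ^- i = 1.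
    apply: (@monodromy_semiregular D _ x regD).
      by rewrite !groupM ?groupV ?groupX.
    by rewrite permM -eq permK.
  move/eqP; rewrite -eq_mulgV1 => /eqP e1.
  have [|im _] := bicyclic_expg_eq p_pr abG (i := m) (i' := i) (j := (n + j)) (j' := 0).
    by rewrite e1 mulg1.
  by rewrite zx; congr (fun_of_perm _ _); apply/eqP; rewrite eq_expg_mod_order ob im.
rewrite mem_porbit porbit_sym; split=> //.
by rewrite -gxy gE permM mem_porbit.
Qed.

(** * Isomorphism and the commutator relation *)

Lemma expg_pair (gT1 gT2 : finGroupType) (x : gT1) (y : gT2) n :
  (x, y) ^+ n = (x ^+ n, y ^+ n).
Proof. by elim: n => // n IH; rewrite !expgS IH. Qed.

(* The subgroup H generated by the pairs of rotations has order at most that   *)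
(* of either monodromy group, so it is the graph of an isomorphism.            *)
Lemma isomorphic_of_commg p d e D D' i j :
    prime p -> odd p -> regular_K p d e D -> regular_K p d e D' ->
    p %| i -> p %| j ->
    [~ rotb D, rotw D] = rotb D ^+ i * rotw D ^+ j ->
    [~ rotb D', rotw D'] = rotb D' ^+ i * rotw D' ^+ j ->
  isomorphic D D'.
Proof.
move=> p_pr p_odd KD KD' pi pj cE cE'.
have abG := bicyclic_monodromy p_pr KD; have abG' := bicyclic_monodromy p_pr KD'.
have oE := card_edge_regular_K KD; have oE' := card_edge_regular_K KD'.
have [[_ oa ob oG] [_ oa' ob' oG']] := (abG, abG').
pose a := (rotb D, rotb D'); pose b := (rotw D, rotw D').
pose H := <<[set a; b]>>%G.
have [aH bH] : a \in H /\ b \in H by rewrite !mem_gen ?set21 ?set22.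
have sH : H \subset setX (monodromy D) (monodromy D').
  by rewrite gen_subG subUset !sub1set !inE /= !rotb_monodromy !rotw_monodromy.
have pH : p.-group H.
  by apply: pgroupS sH _; rewrite /pgroup cardsX oG oG' -expnD pnatX pnat_id.
have cH : [~ a, b] = a ^+ i * b ^+ j.
  by rewrite !expg_pair; congr (_, _).
have oH : #|H| <= p ^ (d + e).
  rewrite -(powerful_mulG p_pr p_odd pH (erefl _) pi pj cH).
  have := mul_cardG <[a]> <[b]>; rewrite -!orderE => eq.
  have : #|<[a]> * <[b]>| <= #[a] * #[b] by rewrite eq leq_pmulr ?cardG_gt0.
  move/leq_trans; apply; rewrite expnD leq_mul // dvdn_leq ?expn_gt0 ?prime_gt0 //.
    by rewrite order_dvdn expg_pair -{1}oa -oa' !expg_order.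
  by rewrite order_dvdn expg_pair -{1}ob -ob' !expg_order.
have [x _ _] := imsetP (dessin_connected D).
have [x' _ _] := imsetP (dessin_connected D').
have surj y : exists2 h : {perm edge D} * {perm edge D'}, h \in H & h.1 x = y.
  have [g gG <-] := monodromy_trans x y.
  have : g \in fst @* H.
    by rewrite morphim_gen ?subsetT // morphimU !morphim_set1 ?inE.
  by case/morphimP=> h _ hH ->; exists h.
have surj' y : exists2 h : {perm edge D} * {perm edge D'}, h \in H & h.2 x' = y.
  have [g gG <-] := monodromy_trans x' y.
  have : g \in snd @* H.
    by rewrite morphim_gen ?subsetT // morphimU !morphim_set1 ?inE.
  by case/morphimP=> h _ hH ->; exists h.
have inj : {in H &, injective (fun h : {perm edge D} * {perm edge D'} => h.1 x)}.
  apply/imset_injP; rewrite eqn_leq leq_imset_card /= (leq_trans oH) // -oE.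
  rewrite -cardsT subset_leq_card //; apply/subsetP => y _.
  by have [h hH <-] := surj y; apply: imset_f.
have inj' : {in H &, injective (fun h : {perm edge D} * {perm edge D'} => h.2 x')}.
  apply/imset_injP; rewrite eqn_leq leq_imset_card /= (leq_trans oH) // -oE'.
  rewrite -cardsT subset_leq_card //; apply/subsetP => y _.
  by have [h hH <-] := surj' y; apply: imset_f.
(* By counting, evaluation at x and at x' is injective on H, so sending [h.1 x] to [h.2 x'] defines
   a bijection of edges. It respects both rotations because a and b lie in H. *)
have ex y : exists z, [exists h in H, (h.1 x == y) && (h.2 x' == z)].
  by have [h hH <-] := surj y; exists (h.2 x'); apply/exists_inP; exists h; rewrite ?eqxx.
pose f y := xchoose (ex y).
have fE h : h \in H -> f (h.1 x) = h.2 x'.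
  move=> hH; have /exists_inP[k kH /andP[/eqP k1 /eqP k2]] := xchooseP (ex (h.1 x)).
  by rewrite /f -k2 (inj _ _ kH hH k1).
exists f; split=> [|y|y].
- apply: inj_card_bij; last by rewrite oE oE'.
  move=> y z; have [h hH <-] := surj y; have [k kH <-] := surj z.
  by rewrite !fE // => /inj' ->.
- have [h hH <-] := surj y; rewrite fE //.
  by have := fE _ (groupM hH aH); rewrite /= !permM.
- have [h hH <-] := surj y; rewrite fE //.
  by have := fE _ (groupM hH bH); rewrite /= !permM.
Qed.

Section Intertwine.
Variables (D D' : dessin) (f : edge D -> edge D').

Definition intertwines (s : {perm edge D}) (s' : {perm edge D'}) : Prop :=
  forall x, f (s x) = s' (f x).

Lemma intertwinesM s s' t t' :
  intertwines s s' -> intertwines t t' -> intertwines (s * t) (s' * t').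
Proof. by move=> fs ft x; rewrite !permM ft fs. Qed.

Lemma intertwinesV s s' : intertwines s s' -> intertwines s^-1 s'^-1.
Proof. by move=> fs x; apply: (@perm_inj _ s'); rewrite -fs !permKV. Qed.

Lemma intertwinesX s s' n : intertwines s s' -> intertwines (s ^+ n) (s' ^+ n).
Proof.
move=> fs; elim: n => [|n IH]; first by move=> x; rewrite !perm1.
by rewrite !expgS; apply: intertwinesM.
Qed.

End Intertwine.

Lemma isomorphic_commg D D' i j : isomorphic D D' ->
    [~ rotb D, rotw D] = rotb D ^+ i * rotw D ^- j ->
  [~ rotb D', rotw D'] = rotb D' ^+ i * rotw D' ^- j.
Proof.
case=> f [[g fK gK] fb fw] cE; apply/permP => y; rewrite -(gK y).
have Ib : intertwines f (rotb D) (rotb D') by [].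
have Iw : intertwines f (rotw D) (rotw D') by [].
have := intertwinesM (intertwinesX i Ib) (intertwinesV (intertwinesX j Iw)).
move/(_ (g y)) => <-; rewrite -cE.
have := intertwinesM (intertwinesV Ib)
  (intertwinesM (intertwinesV Iw) (intertwinesM Ib Iw)).
by move/(_ (g y))/esym.
Qed.

Lemma isomorphic_card_black D D' : isomorphic D D' -> #|black D| = #|black D'|.
Proof.
case=> f [bf fb _]; have injf := bij_inj bf.
have Ib : intertwines f (rotb D) (rotb D') by [].
rewrite -(card_imset _ (imset_inj injf)); congr #|pred_of_set _|.
have porbE x : f @: porbit (rotb D) x = porbit (rotb D') (f x).
  apply/setP => y; apply/imsetP/porbitP => [[_ /porbitP[n ->] ->]|[n ->]].
    by exists n; apply: intertwinesX.
  by exists ((rotb D ^+ n) x); rewrite ?mem_porbit // (intertwinesX n Ib).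
have [g fK gK] := bf.
apply/setP => A; apply/imsetP/imsetP => [[_ /imsetP[x _ ->] ->]|[y _ ->]].
  by exists (f x).
by exists (porbit (rotb D) (g y)); rewrite ?imset_f // porbE gK.
Qed.

(** * The regular dessin of a generating pair *)

Section CayleyDessin.
Variables (gT : finGroupType) (G : {group gT}) (a b : gT).
Hypothesis defG : G :=: <<[set a; b]>>.

(** Rotations act by right multiplication, so that left multiplications are automorphisms. *)
Definition right_translation (g : gT) : {perm subg_of G} := perm (mulIg (subg G g)).

Lemma right_translationM : {in G &, {morph right_translation : g h / g * h}}.
Proof.
move=> g h gG hG; apply/permP => x.
by rewrite permM !permE subgM // mulgA.
Qed.
Canonical right_translation_morphism := Morphism right_translationM.

Lemma right_translation_injm : 'injm right_translation_morphism.
Proof.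
apply/injmP => g h gG hG /permP/(_ 1); rewrite !permE !mul1g => e.
by rewrite -(subgK g gG) -(subgK h hG) /= e.
Qed.

Let aG : a \in G. Proof. by rewrite defG mem_gen ?set21. Qed.
Let bG : b \in G. Proof. by rewrite defG mem_gen ?set22. Qed.

Lemma right_translation_gen :
  <<[set right_translation a; right_translation b]>> = right_translation @* G.
Proof.
have sG : [set a; b] \subset G by rewrite defG subset_gen.
by rewrite {2}defG morphim_gen // morphimU !morphim_set1.
Qed.

Lemma right_translation_trans :
  [transitive <<[set right_translation a; right_translation b]>>,
    on [set: subg_of G] | 'P].
Proof.
rewrite right_translation_gen; apply/imsetP; exists 1; rewrite ?inE //.
apply/setP => x; rewrite inE; apply/esym/orbitP.
exists (right_translation (sgval x)); first by rewrite mem_morphim ?subgP.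
by rewrite /= /aperm permE mul1g sgvalK.
Qed.

Definition cayley_dessin : dessin := Dessin right_translation_trans.

Lemma cayley_dessin_regular : regular cayley_dessin.
Proof.
move=> x y; exists (perm (mulgI (y * x^-1 : subg_of G))); last by rewrite permE mulgKV.
split; first exact: (Bijective (permK _) (permKV _)).
  by move=> z; rewrite !permE mulgA.
by move=> z; rewrite !permE mulgA.
Qed.

Lemma bicyclic_cayley_dessin p d e : bicyclic p d e G a b ->
  bicyclic p d e (monodromy cayley_dessin) (rotb cayley_dessin) (rotw cayley_dessin).
Proof.
case=> GE oa ob oG; have injr := right_translation_injm; split.
- rewrite /= right_translation_gen -[X in _ @* X]GE morphimMl ?cycle_subG //.
  by rewrite !morphim_cycle.
- by rewrite -oa; apply: (order_injm injr).
- by rewrite -ob; apply: (order_injm injr).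
by rewrite /= right_translation_gen card_injm.
Qed.

Lemma cayley_dessin_commg i j : [~ a, b] = a ^+ i * b ^+ j ->
  [~ rotb cayley_dessin, rotw cayley_dessin] =
  rotb cayley_dessin ^+ i * rotw cayley_dessin ^+ j.
Proof.
move=> cE; rewrite /= -(morphR right_translation_morphism) //= cE.
by rewrite (morphM right_translation_morphism) ?(morphX right_translation_morphism) ?groupX.
Qed.

End CayleyDessin.

(* Writing the second exponent with a minus sign makes the passage to the      *)
(* reciprocal dessin exchange x and y when k = 1.                              *)
Definition has_code p k D x y : Prop :=
  [~ rotb D, rotw D] = rotb D ^+ (p * x) * rotw D ^- (p ^ k * y).

Lemma has_code_reciprocal p D x y :
  has_code p 1 D x y -> has_code p 1 (reciprocal D) y x.
Proof. by rewrite /has_code !expn1 /= => c; rewrite -invg_comm c invMg invgK. Qed.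

(** * Classification by codes *)

Section Codes.
Variables (p d e : nat).
Hypotheses (p_pr : prime p) (p_odd : odd p) (le_de : d <= e).

(** This merges the two conditions p | j and p^(e-d) | j. *)
Let k := maxn 1 (e - d).
Let n0 : (0 < p ^ e)%N. Proof. by rewrite expn_gt0 prime_gt0. Qed.

Lemma rotw_expV D m : regular_K p d e D ->
  rotw D ^- m = rotw D ^+ ((p ^ e).-1 * m).
Proof.
move=> KD; have [_ _ ob _] := bicyclic_monodromy p_pr KD.
by apply/(canLR invgK)/esym/expg_pred_mul; rewrite // -ob expg_order.
Qed.

Lemma has_code_isomorphic D D' x y : regular_K p d e D -> regular_K p d e D' ->
  has_code p k D x y -> has_code p k D' x y -> isomorphic D D'.
Proof.
move=> KD KD'; rewrite /has_code !(rotw_expV _ KD) !(rotw_expV _ KD') => c c'.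
apply: isomorphic_of_commg p_pr p_odd KD KD' _ _ c c'; first exact: dvdn_mulr.
by rewrite dvdn_mull // dvdn_mulr // -{1}(expn1 p) dvdn_exp2l // leq_maxl.
Qed.

Lemma has_code_exists D : regular_K p d e D ->
  exists (x : 'I_(p ^ (d - 1))) (y : 'I_(p ^ (e - k))), has_code p k D x y.
Proof.
move=> KD; have abG := bicyclic_monodromy p_pr KD.
have [_ oa ob _] := abG; have p0 := prime_gt0 p_pr.
have [i [j [lti ltj pi pj cE]]] := bicyclic_commg_code p_pr abG.
have pej := bicyclic_code_dvdn p_pr p_odd abG pi pj cE.
have : rotw D ^+ j \in <[(rotw D)^-1]> by rewrite cycleV mem_cycle.
case/cyclePmin=> m; rewrite orderV ob => ltm jm.
have pejm : (p ^ e %| j + m)%N.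
  by rewrite -ob order_dvdn expgD jm expVgn mulVg.
have pkm : (p ^ k %| m)%N.
  have [e0|e0] := posnP e.
    by move: ltm; rewrite e0 ltnS leqn0 => /eqP->.
  have ke : k <= e by rewrite geq_max e0 leq_subr.
  rewrite -(dvdn_addr m (_ : (p ^ k %| j)%N)); first exact: dvdn_trans (dvdn_exp2l p ke) pejm.
  by rewrite /k; case: leqP => _; rewrite ?expn1.
(* For d = 0 the truncated [d - 1] is 0, leaving the single value x = 0, as it should. *)
have ltx : i %/ p < p ^ (d - 1).
  have [d0|d0] := posnP d.
    by move: lti; rewrite d0 ltnS leqn0 => /eqP->; rewrite div0n.
  by rewrite ltn_divLR // -expnSr subn1 prednK.
have lty : m %/ p ^ k < p ^ (e - k).
  have [e0|e0] := posnP e.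
    by move: ltm; rewrite e0 ltnS leqn0 => /eqP->; rewrite div0n.
  have ke : k <= e by rewrite geq_max e0 leq_subr.
  by rewrite ltn_divLR ?expn_gt0 ?p0 // -expnD subnK.
exists (Ordinal ltx), (Ordinal lty).
by rewrite /has_code /= !(mulnC _ (_ %/ _)) !divnK // cE jm expVgn.
Qed.

Lemma has_code_inj D (x x' : 'I_(p ^ (d - 1))) (y y' : 'I_(p ^ (e - k))) :
    regular_K p d e D -> has_code p k D x y -> has_code p k D x' y' ->
  x = x' /\ y = y'.
Proof.
move=> KD; rewrite /has_code => -> eq; have p0 := prime_gt0 p_pr.
have abG : bicyclic p d e (monodromy D) (rotb D) (rotw D)^-1.
  have [defG oa ob oG] := bicyclic_monodromy p_pr KD.
  by split; rewrite ?cycleV ?orderV.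
have [|ex ey] := bicyclic_expg_eq p_pr abG
  (i := p * x) (i' := p * x') (j := p ^ k * y) (j' := p ^ k * y').
  by rewrite !expVgn.
split; apply: val_inj.
  have [d0|d0] := posnP d.
    case: x x' {eq ex} => [x +] [x' +] /=; rewrite d0 !ltnS !leqn0.
    by move=> /eqP-> /eqP->.
  have lt (z : 'I_(p ^ (d - 1))) : (p * z < p ^ d)%N.
    have -> : (p ^ d = p * p ^ (d - 1))%N by rewrite -expnS subn1 prednK.
    by rewrite ltn_pmul2l.
  by move/eqP: ex; rewrite !modn_small // eqn_pmul2l // => /eqP.
have [e0|e0] := posnP e.
  case: y y' {eq ey} => [y +] [y' +] /=; rewrite e0 !ltnS !leqn0.
  by move=> /eqP-> /eqP->.
have ke : k <= e by rewrite geq_max e0 leq_subr.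
have lt (z : 'I_(p ^ (e - k))) : (p ^ k * z < p ^ e)%N.
  have -> : (p ^ e = p ^ k * p ^ (e - k))%N by rewrite -expnD subnKC.
  by rewrite ltn_pmul2l // expn_gt0 p0.
by move/eqP: ey; rewrite !modn_small // eqn_pmul2l ?expn_gt0 ?p0 // => /eqP.
Qed.

Lemma has_code_realized x y : exists D, regular_K p d e D /\ has_code p k D x y.
Proof.
have pk : p %| p ^ k by rewrite -{1}(expn1 p) dvdn_exp2l // leq_maxl.
have [||| gT [G [a [b [abG cE]]]]] := @bicyclic_exists p d e
   (p * x) ((p ^ e).-1 * (p ^ k * y)) p_pr p_odd le_de.
- exact: dvdn_mulr.
- by rewrite dvdn_mull // dvdn_mulr.
- by rewrite dvdn_mull // dvdn_mulr // dvdn_exp2l // leq_maxr.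
pose D := cayley_dessin (bicyclic_gen abG).
have KD : regular_K p d e D.
  apply: regular_K_of_bicyclic p_pr _ _; first exact: cayley_dessin_regular.
  exact: bicyclic_cayley_dessin.
exists D; split=> //; rewrite /has_code (rotw_expV _ KD).
exact: cayley_dessin_commg.
Qed.

(** The codes form a finite type, so representatives can be chosen for all of them at once. *)
Lemma has_code_dessins :
  exists F : 'I_(p ^ (d - 1)) * 'I_(p ^ (e - k)) -> dessin,
    forall u, regular_K p d e (F u) /\ has_code p k (F u) u.1 u.2.
Proof.
pose Q (u : 'I_(p ^ (d - 1)) * 'I_(p ^ (e - k))) D :=
  regular_K p d e D /\ has_code p k D u.1 u.2.
have exQ u : exists D, Q u D := has_code_realized u.1 u.2.
by have [F FP] := fin_all_exists exQ; exists F.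
Qed.

Lemma isomorphic_has_code_eq D D' (x x' : 'I_(p ^ (d - 1))) (y y' : 'I_(p ^ (e - k))) :
    regular_K p d e D' -> has_code p k D x y -> has_code p k D' x' y' ->
    isomorphic D D' ->
  x = x' /\ y = y'.
Proof.
move=> KD' c c' iso; apply: has_code_inj KD' _ c'.
exact: isomorphic_commg iso c.
Qed.

End Codes.

(** * Counting reciprocal pairs *)

Lemma regular_K_reciprocal p d e D :
  regular_K p d e D -> regular_K p e d (reciprocal D).
Proof.
case=> regD cb cw int; split=> // [a b|B W bB wW]; last by rewrite setIC int.
by have [f [bf fb fw] fab] := regD a b; exists f.
Qed.

Lemma regular_K_underlying p d e D : regular_K p d e D ->
  regular D /\ underlying_graph_K (p ^ d) (p ^ e) D.
Proof. by case=> regD cb cw int; split=> //; split=> //; right. Qed.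

Lemma underlying_regular_K p d e D :
    regular D /\ underlying_graph_K (p ^ d) (p ^ e) D ->
  regular_K p d e D \/ regular_K p d e (reciprocal D).
Proof.
case=> regD [[[cb cw]|[cb cw]] int]; last by left.
by right; apply: (@regular_K_reciprocal p e d D).
Qed.

Lemma number_of_classes_card (I : finType) (A : {set I}) (T : Type)
    (P : T -> Prop) (R : T -> T -> Prop) (F : I -> T) :
    (forall u, u \in A -> P (F u)) ->
    (forall u v, u \in A -> v \in A -> R (F u) (F v) -> u = v) ->
    (forall x, P x -> exists2 u, u \in A & R x (F u)) ->
  number_of_classes P R #|A|.
Proof.
move=> PF injF surjF; exists (fun i => F (enum_val i)); split.
- by move=> i; apply/PF/enum_valP.
- by move=> i j /injF; rewrite !enum_valP => /(_ isT isT) /enum_val_inj.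
by move=> x /surjF[u uA xu]; exists (enum_rank_in uA u); rewrite enum_rankK_in.
Qed.

(** Each pair has a member with p^e black vertices. Two such members cannot be reciprocal, since the
    colour classes differ in size, so the pairs correspond to the codes. *)
Lemma number_of_reciprocal_pairs_lt p d e : prime p -> odd p -> d < e ->
  number_of_reciprocal_pairs (p ^ d) (p ^ e) (p ^ (d - 1 + (e - maxn 1 (e - d)))).
Proof.
move=> p_pr p_odd lt_de; have le_de := ltnW lt_de.
have [F FP] := has_code_dessins p_pr p_odd le_de.
have -> : (p ^ (d - 1 + (e - maxn 1 (e - d))))%N =
    #|[set: 'I_(p ^ (d - 1)) * 'I_(p ^ (e - maxn 1 (e - d)))]|.
  by rewrite cardsT card_prod !card_ord expnD.
apply: (@number_of_classes_card _ _ _ _ _ F).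
- by move=> u _; apply: regular_K_underlying; case: (FP u).
- move=> u v _ _; have [Ku cu] := FP u; have [Kv cv] := FP v; case=> iso.
    have [] := isomorphic_has_code_eq p_pr Kv cu cv iso.
    by case: u {Ku cu iso} => ? ?; case: v {Kv cv} => ? ? /= -> ->.
  have := isomorphic_card_black iso; case: Ku => _ -> _ _; case: Kv => _ _ + _.
  rewrite /black /white /= => -> /eqP.
  by rewrite eqn_exp2l ?prime_gt1 // gtn_eqF.
move=> D /underlying_regular_K[] KD.
  have [x [y c]] := has_code_exists p_pr p_odd KD.
  exists (x, y); rewrite ?inE //; left.
  have [Ku cu] := FP (x, y); exact: (has_code_isomorphic p_pr p_odd KD Ku c cu).
have [x [y c]] := has_code_exists p_pr p_odd KD.
exists (x, y); rewrite ?inE //; right.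
have [Ku cu] := FP (x, y).
have [f [bf fb fw]] := has_code_isomorphic p_pr p_odd KD Ku c cu.
by exists f.
Qed.

(** The two triangles of the square have equal size, cover it and meet in the diagonal. *)
Lemma card_ord_pairs_le m : #|[set u : 'I_m * 'I_m | u.1 <= u.2]| = (m * (1 + m) %/ 2)%N.
Proof.
pose A := [set u : 'I_m * 'I_m | u.1 <= u.2].
pose B := [set u : 'I_m * 'I_m | u.2 <= u.1].
have cAB : #|A| = #|B|.
  have swI : injective (fun u : 'I_m * 'I_m => (u.2, u.1)) by move=> [? ?] [? ?] [-> ->].
  rewrite -(card_imset _ swI); congr #|pred_of_set _|; apply/setP => -[x y]; rewrite inE.
  by apply/imsetP/idP => [[[? ?]]|le]; [rewrite inE => ? [-> ->] | exists (y, x); rewrite ?inE].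
have cI : #|A :&: B| = m.
  rewrite -[RHS]card_ord -(card_imset _ (_ : injective (fun x : 'I_m => (x, x)))).
    congr #|pred_of_set _|; apply/setP => -[x y]; rewrite !inE -eqn_leq /=.
    by apply/eqP/imsetP => [/val_inj->|[z _ [-> ->]]//]; exists y.
  by move=> x y [].
have cU : A :|: B = setT by apply/setP => u; rewrite !inE leq_total.
have := cardsUI A B; rewrite cU cardsT card_prod card_ord cI -cAB -/A => eq.
by rewrite mulnDr muln1 addnC eq addnn -muln2 mulnK.
Qed.

(** Here k = 1 and reciprocity swaps the code (x, y), so codes with x <= y represent the pairs. *)
Lemma number_of_reciprocal_pairs_eq p e : prime p -> odd p ->
  number_of_reciprocal_pairs (p ^ e) (p ^ e)
    (p ^ (e - 1) * (1 + p ^ (e - 1)) %/ 2).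
Proof.
move=> p_pr p_odd.
have [F FP] := has_code_dessins p_pr p_odd (leqnn e).
rewrite -card_ord_pairs_le.
have isoE := @isomorphic_has_code_eq p e e p_pr.
have isoI := @has_code_isomorphic p e e p_pr p_odd.
have ex := @has_code_exists p e e p_pr p_odd.
move: F FP isoE isoI ex; rewrite subnn maxn0 => F FP isoE isoI ex.
apply: (@number_of_classes_card _ _ _ _ _ F).
- by move=> u _; apply: regular_K_underlying; case: (FP u).
- move=> [x y] [x' y']; rewrite !inE /= => le le'.
  have [Ku cu] := FP (x, y); have [Kv cv] := FP (x', y'); case=> iso.
    by have [/= -> ->] := isoE _ _ _ _ _ _ Kv cu cv iso.
  have [/= ex1 ey1] := isoE _ _ _ _ _ _ (regular_K_reciprocal Kv) cu (has_code_reciprocal cv) iso.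
  subst x y; have e1 : x' = y' by apply/val_inj/eqP; rewrite eqn_leq le' le.
  by rewrite e1.
move=> D PD.
have KD : regular_K p e e D.
  by case: (underlying_regular_K PD) => // /regular_K_reciprocal; case.
have [x [y c]] := ex D KD; have [le|/ltnW le] := leqP x y.
  exists (x, y); rewrite ?inE //; left.
  by have [Ku cu] := FP (x, y); apply: isoI KD Ku c cu.
exists (y, x); rewrite ?inE //; right.
have [Ku cu] := FP (y, x).
exact: isoI KD (regular_K_reciprocal Ku) c (has_code_reciprocal cu).
Qed.

(** * Type and genus *)

Lemma has_type_regular_K p d e D : prime p -> odd p -> d <= e ->
    regular_K p d e D ->
  has_type D (p ^ d) (p ^ e) (p ^ e) /\ #|faces D| = (p ^ d)%N.
Proof.
move=> p_pr p_odd le_de KD; have abG := bicyclic_monodromy p_pr KD.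
have [[regD _ _ _] [_ oa ob _]] := (KD, abG).
have [bG wG] := (rotb_monodromy D, rotw_monodromy D).
have [i [j [_ _ pi pj cE]]] := bicyclic_commg_code p_pr abG.
have oab := bicyclic_order_mul p_pr p_odd abG pi pj cE le_de.
split; last first.
  have := card_porbits_regular regD (groupM bG wG); rewrite oab (card_edge_regular_K KD).
  by rewrite expnD => /eqP; rewrite eqn_pmul2r ?expn_gt0 ?prime_gt0 // => /eqP.
split=> _ /imsetP[x _ ->].
- by rewrite card_porbit_regular.
- by rewrite card_porbit_regular.
by rewrite /face_length card_porbit_regular ?groupM // oab.
Qed.

(** Faces number p^(d+e) / p^e = p^d, so the Euler characteristic is 2 p^d + p^e - p^(d+e). *)
Lemma genus_regular_K p d e D : prime p -> odd p -> d <= e -> regular_K p d e D ->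
  genus D = (2^-1 * ((p ^ d)%:R - 1) * ((p ^ e)%:R - 2))%R.
Proof.
move=> p_pr p_odd le_de KD; have [_ cb cw _] := KD.
have [_ cf] := has_type_regular_K p_pr p_odd le_de KD.
rewrite /genus /euler_char cb cw cf (card_edge_regular_K KD) expnD.
rewrite PoszD PoszM -!natz.
rewrite !(GRing.rmorphD, GRing.rmorphB, GRing.rmorphM, GRing.rmorph_nat) /=.
by field.
Qed.

Lemma regular_K_of_valency p d e D : prime p -> regular D ->
    underlying_graph_K (p ^ d) (p ^ e) D ->
    (forall B, B \in black D -> #|B| = (p ^ d)%N) ->
  regular_K p d e D.
Proof.
move=> p_pr regD UD val; have [cards int] := UD.
case: cards => -[cb cw]; last by split.
have KD : regular_K p e d D by split.
have [_ ob _ _] := bicyclic_monodromy p_pr KD.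
have [x _ _] := imsetP (dessin_connected D).
have := val _ (black_porbit x).
rewrite (card_porbit_regular x regD (rotb_monodromy D)) ob => /eqP.
by rewrite eqn_exp2l ?prime_gt1 // => /eqP de; rewrite de in KD *.
Qed.

End Dessins.

Theorem theorem1p1 (p d e : nat) (p_prime : prime p) (p_odd : odd p)
    (le_de : d <= e) :
  [/\ d = 0 -> number_of_reciprocal_pairs (p ^ d) (p ^ e) 1,
      0 < d -> d = e ->
        number_of_reciprocal_pairs (p ^ d) (p ^ e)
          (p ^ (e - 1) * (1 + p ^ (e - 1)) %/ 2),
      0 < d -> d < e ->
        number_of_reciprocal_pairs (p ^ d) (p ^ e) (p ^ (2 * d - 1)) &
      forall D : dessin, regular D -> underlying_graph_K (p ^ d) (p ^ e) D ->
        (forall B, B \in black D -> #|B| = p ^ d) ->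
        has_type D (p ^ d) (p ^ e) (p ^ e) /\
        genus D = (2^-1 * ((p ^ d)%:R - 1) * ((p ^ e)%:R - 2))%R].
Proof.
split=> [d0|_ ->|d0 lt_de|D regD UD val].
(* For e = 0 the square count gives 1 (1 + 1) / 2 = 1. For e > 0, k equals e and a single code
   remains. *)
- move: le_de; rewrite {}d0; case: e => [|e] _.
    exact: (number_of_reciprocal_pairs_eq 0 p_prime p_odd).
  have := number_of_reciprocal_pairs_lt p_prime p_odd (ltn0Sn e).
  by rewrite subn0 maxnE subnKC // subnn.
- exact: number_of_reciprocal_pairs_eq.
- have := number_of_reciprocal_pairs_lt p_prime p_odd lt_de.
  by congr (number_of_reciprocal_pairs _ _ (p ^ _)); lia.
have KD := regular_K_of_valency p_prime regD UD val.
split; last exact: genus_regular_K.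
by have [] := has_type_regular_K p_prime p_odd le_de KD.
Qed.
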